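(* Let $\mathcal{B}=(B_t)_{t\in G}$ be a Fell bundle over a discrete group $G$, and for $t\in G$ let $X_t=\{\pi\in\widehat{B_e}:\pi|_{D_t}\neq 0\}$, where $D_t=B_tB_t^*$, and let $\hat{\alpha}_t:X_{t^{-1}}\to X_t$ be the homeomorphism $\hat{\alpha}_t=r_t^{-1}\circ \mathrm{Ind}_{B_t}\circ r_{t^{-1}}$. Then $\hat{\alpha}:=\big(\{X_t\}_{t\in G},\{\hat{\alpha}_t\}_{t\in G}\big)$ is a partial action of $G$ on $\widehat{B_e}$.
   Context: For subsets $X\subseteq B_s$, $Y\subseteq B_t$ of fibers of a Fell bundle, $XY$ denotes the closed linear span of $\{xy:x\in X,y\in Y\}$ in $B_{st}$, and $X^*=\{x^*:x\in X\}$. The unit fiber $B_e$ is a $C^*$-algebra. $D_t=B_tB_t^*$ is a closed two-sided ideal of $B_e$, and $B_t$ is a $D_t$-$D_{t^{-1}}$ imprimitivity bimodule, with left and right multiplication and with left and right inner products $b_1b_2^*$ and $b_1^*b_2$. For a $C^*$-algebra $A$, $\hat A$ is its spectrum: the set of unitary equivalence classes of irreducible representations, with the initial topology for the map $[\pi]\mapsto\ker\pi$ into the primitive ideal space with the hull-kernel topology (classes are denoted by representatives). If $J$ is an ideal of $A$, $X_J=\{\pi\in\hat A:\pi|_J\ne0\}$ is open and $r_J:X_J\to\hat J$, $r_J(\pi)=\pi|_J$, is a homeomorphism; $X_t:=X_{D_t}\subseteq\widehat{B_e}$ and $r_t:=r_{D_t}$. $\mathrm{Ind}_{B_t}:\hat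 D_{t^{-1}}\to\hat D_t$ is the Rieffel induction homeomorphism: for $\pi$ an irreducible representation of $D_{t^{-1}}$ on $H_\pi$, $\mathrm{Ind}_{B_t}\pi$ acts on the Hilbert space $B_t\otimes_{D_{t^{-1}}}H_\pi$ (completion of the algebraic tensor product for $\langle x\otimes h,y\otimes k\rangle=\langle\pi(y^*x)h,k\rangle$) by $\mathrm{Ind}_{B_t}\pi(a)(x\otimes h)=ax\otimes h$. A partial action of a discrete group $G$ on a topological space $X$ is a family of open sets $X_t\subseteq X$ and homeomorphisms $\theta_t:X_{t^{-1}}\to X_t$ $(t\in G)$ such that $X_e=X$, $\theta_e=\mathrm{id}_X$, and $\theta_{st}$ extends $\theta_s\theta_t$ (the composition being defined on its maximal domain $\{x\in X_{t^{-1}}:\theta_t(x)\in X_{s^{-1}}\}$) for all $s,t\in G$. *)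

(* Defs.v *)
From HB Require Import structures.
From mathcomp Require Import all_boot all_order all_algebra.
From mathcomp Require Import complex.
From mathcomp Require Import all_classical all_reals all_analysis.

Set Implicit Arguments.
Unset Strict Implicit.
Unset Printing Implicit Defensive.

Import Order.TTheory GRing.Theory Num.Theory.
Import numFieldNormedType.Exports.

Local Open Scope classical_set_scope.
Local Open Scope ring_scope.

(* The spectrum of a C*-algebra has classes of representations as points, and
   must itself be a [topologicalType].  The carriers of Banach and Hilbert
   spaces therefore have to live in a universe strictly below that of
   [choiceType]: the record is built from plain fields, and the library structures are
   attached to it afterwards. *)
Record normedSpace (K : numFieldType) := NormedSpace {
  ns_car :> Type;
  ns_zero : ns_car;
  ns_opp : ns_car -> ns_car;
  ns_add : ns_car -> ns_car -> ns_car;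
  ns_scale : K -> ns_car -> ns_car;
  ns_norm : ns_car -> K;
  ns_addA : associative ns_add;
  ns_addC : commutative ns_add;
  ns_add0 : left_id ns_zero ns_add;
  ns_addN : left_inverse ns_zero ns_opp ns_add;
  ns_scaleA : forall a b v, ns_scale a (ns_scale b v) = ns_scale (a * b) v;
  ns_scale1 : left_id 1 ns_scale;
  ns_scaleDr : right_distributive ns_scale ns_add;
  ns_scaleDl : forall v, {morph ns_scale^~ v : a b / a + b >-> ns_add a b};
  ns_normD : forall x y, ns_norm (ns_add x y) <= ns_norm x + ns_norm y;
  ns_normZ : forall a x, ns_norm (ns_scale a x) = `|a| * ns_norm x;
  ns_norm0 : forall x, ns_norm x = 0 -> x = ns_zero }.

Section NormedSpaceInstances.
Context (K : numFieldType) (V : normedSpace K).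
HB.instance Definition _ := gen_eqMixin (ns_car V).
HB.instance Definition _ := gen_choiceMixin (ns_car V).
HB.instance Definition _ := GRing.isZmodule.Build (ns_car V)
  (@ns_addA K V) (@ns_addC K V) (@ns_add0 K V) (@ns_addN K V).
HB.instance Definition _ := GRing.Zmodule_isLmodule.Build K (ns_car V)
  (@ns_scaleA K V) (@ns_scale1 K V) (@ns_scaleDr K V) (@ns_scaleDl K V).
HB.instance Definition _ := Lmodule_isNormed.Build K (ns_car V)
  (@ns_normD K V) (@ns_normZ K V) (@ns_norm0 K V).
End NormedSpaceInstances.

Record banachSpace (K : numFieldType) := BanachSpace {
  bs_space :> normedSpace K;
  bs_complete : forall F : set_system bs_space,
    ProperFilter F -> cauchy F -> cvg F }.

HB.instance Definition _ (K : numFieldType) (V : banachSpace K) :=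
  Uniform_isComplete.Build (ns_car V) (@bs_complete K V).

(* Inner products are linear in the first variable. *)
Record hilbertSpace (R : realType) := HilbertSpace {
  hs_space :> banachSpace R[i];
  hdot : hs_space -> hs_space -> R[i];
  hdot_linear : forall y, scalar (hdot^~ y);
  hdot_conj : forall x y, hdot x y = (hdot y x)^*;
  hdot_norm : forall x, hdot x x = `|x| ^+ 2 }.

Definition linear_subspace (K : numFieldType) (V : lmodType K) (S : set V) :=
  S 0 /\ forall (k : K) x y, S x -> S y -> S (k *: x + y).

Definition linear_span (K : numFieldType) (V : lmodType K) (S : set V) : set V :=
  [set v | exists (n : nat) (c : 'I_n -> K) (x : 'I_n -> V),
     (forall i, S (x i)) /\ v = \sum_(i < n) c i *: x i].

Definition closed_span (K : numFieldType) (V : normedModType K) (S : set V) :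
  set V := closure (linear_span S).

Lemma linear_span_sub (K : numFieldType) (V : lmodType K) (S T : set V) :
  linear_subspace T -> S `<=` T -> linear_span S `<=` T.
Proof.
move=> [T0 Tl] ST _ [n [c [x [Sx ->]]]].
elim/big_ind : _ => [//|u v Tu Tv|j _].
  by rewrite -[u]scale1r; exact: Tl.
by rewrite -[_ *: _]addr0; apply: Tl => //; exact: ST.
Qed.

Lemma linear_span_subspace (K : numFieldType) (V : lmodType K) (S : set V) :
  linear_subspace (linear_span S).
Proof.
split.
  exists 0%N, (fun=> 0), (fun=> 0); split; last by rewrite big_ord0.
  by case.
move=> k _ _ [m [c [x [Sx ->]]]] [n [d [y [Sy ->]]]].
exists (m + n)%N,
  (fun i : 'I_(m + n) => match fintype.split i with inl j => k * c j | inr j => d j end),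
  (fun i : 'I_(m + n) => match fintype.split i with inl j => x j | inr j => y j end).
split.
  by move=> j; case: (fintype.split j).
rewrite big_split_ord /= scaler_sumr; congr (_ + _); apply: eq_bigr => j _.
  by case: fintype.splitP => [l /= /val_inj <-|l /= jl]; [rewrite scalerA|
    move: (ltn_ord j); rewrite jl ltnNge leq_addr].
case: fintype.splitP => [l /= jl|l /= /addnI /val_inj <- //].
by move: (ltn_ord l); rewrite -jl ltnNge leq_addr.
Qed.

Lemma linear_span_incl (K : numFieldType) (V : lmodType K) (S : set V) :
  S `<=` linear_span S.
Proof.
move=> x Sx; exists 1%N, (fun=> 1), (fun=> x); split=> //.
by rewrite big_ord1 scale1r.
Qed.

Lemma closure_image (V W : topologicalType) (f : V -> W) (S : set V) (T : set W) :
  continuous f -> (forall x, S x -> closure T (f x)) ->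
  forall x, closure S x -> closure T (f x).
Proof.
move=> fc ST x Sx; have cT : closed (f @^-1` closure T).
  by apply: preimage_closed => [? _|]; [exact: fc|exact: closed_closure].
have : closure (f @^-1` closure T) x by apply: closureS Sx; exact: ST.
by rewrite -((closure_id _).1 cT).
Qed.

Lemma closed_span_subspace (K : numFieldType) (V : normedModType K) (S : set V) :
  linear_subspace (closed_span S).
Proof.
have [S0 Sl] := linear_span_subspace S.
split; first exact: subset_closure.
move=> k x y Sx; apply: (closure_image (f := fun y => k *: x + y)) => [z|{}y Sy].
  by apply: cvgD => //; exact: cvg_cst.
move: x Sx; apply: (closure_image (f := fun x => k *: x + y)) => [z|x Sx].
  by apply: cvgD; [exact: cvgZr|exact: cvg_cst].
by apply: subset_closure; exact: Sl.
Qed.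

Lemma closed_span_incl (K : numFieldType) (V : normedModType K) (S : set V) :
  S `<=` closed_span S.
Proof. by move=> x Sx; apply/subset_closure/linear_span_incl. Qed.

Lemma closed_span_image (K : numFieldType) (V : normedModType K) (f : V -> V)
    (S : set V) :
  (forall u v, f (u + v) = f u + f v) ->
  (forall k v, closed_span S (f v) -> closed_span S (f (k *: v))) ->
  f 0 = 0 -> continuous f -> (forall x, S x -> closed_span S (f x)) ->
  forall x, closed_span S x -> closed_span S (f x).
Proof.
move=> fD fZ f0 fc fS; apply: closure_image => // x.
move: x; apply: linear_span_sub => [|//].
have [C0 Cl] := closed_span_subspace S.
split=> [|k u v Su Sv]; first by rewrite /= f0.
rewrite /= fD -[f (k *: u)]scale1r; apply: Cl => //.
by apply: fZ.
Qed.

Lemma lipschitz_continuous (K : numFieldType) (V W : normedModType K)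
    (f : V -> W) (M : K) :
  0 <= M -> (forall x y, `|f x - f y| <= M * `|x - y|) -> continuous f.
Proof.
move=> M0 fM x; apply/cvgrPdist_le => e e0.
have M1 : 0 < M + 1 by rewrite ltr_wpDl.
near=> y.
apply: (le_trans (fM x y)).
have : M * `|x - y| <= (M + 1) * `|x - y| by rewrite ler_wpM2r// lerDl.
move=> /le_trans; apply; rewrite mulrC -ler_pdivlMr//; near: y.
by apply: cvgr_dist_le => //; exact: divr_gt0.
Unshelve. all: by end_near. Qed.

(* C*-algebras, not necessarily unital. *)
Record cstarAlg (R : realType) := CstarAlg {
  ca_space :> banachSpace R[i];
  cmul : ca_space -> ca_space -> ca_space;
  cstar : ca_space -> ca_space;
  cmulA : associative cmul;
  cmul_linl : forall b, linear (cmul^~ b);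
  cmul_linr : forall a, linear (cmul a);
  cmul_norm : forall a b, `|cmul a b| <= `|a| * `|b|;
  cstar_semilin : forall (k : R[i]) a b,
    cstar (k *: a + b) = k^* *: cstar a + cstar b;
  cstarK : involutive cstar;
  cstarM : forall a b, cstar (cmul a b) = cmul (cstar b) (cstar a);
  cstar_norm : forall a, `|cmul (cstar a) a| = `|a| ^+ 2 }.

Record subCstar (R : realType) (A : cstarAlg R) := SubCstar {
  sc_set : set A;
  sc_lin : linear_subspace sc_set;
  sc_closed : closed sc_set;
  sc_mul : forall a b, sc_set a -> sc_set b -> sc_set (cmul a b);
  sc_star : forall a, sc_set a -> sc_set (cstar a) }.

Arguments sc_closed {R A} S : rename.

Section SubCstarAlg.
Context (R : realType) (A : cstarAlg R) (S : subCstar A).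

Definition sc_car := {x : ns_car A | sc_set S x}.

Let sc_inj (x y : sc_car) : sval x = sval y -> x = y.
Proof. by case: x y => [x Sx] [y Sy] /= xy; exact: eq_exist. Qed.

Let sc_add_closed (x y : sc_car) : sc_set S (sval x + sval y).
Proof.
have [_ /(_ 1 (sval x) (sval y) (svalP x) (svalP y))] := sc_lin S.
by rewrite scale1r.
Qed.

Let sc_scale_closed (k : R[i]) (x : sc_car) : sc_set S (k *: sval x).
Proof.
have [S0 /(_ k (sval x) 0 (svalP x) S0)] := sc_lin S.
by rewrite addr0.
Qed.

Let sc_opp_closed (x : sc_car) : sc_set S (- sval x).
Proof. by rewrite -scaleN1r; exact: sc_scale_closed. Qed.

Definition sc_normedSpace : normedSpace R[i].
Proof.
refine (@NormedSpace R[i] sc_car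
  (exist _ 0 (sc_lin S).1)
  (fun x => exist _ (- sval x) (sc_opp_closed x))
  (fun x y => exist _ (sval x + sval y) (sc_add_closed x y))
  (fun k x => exist _ (k *: sval x) (sc_scale_closed k x))
  (fun x => `|sval x|) _ _ _ _ _ _ _ _ _ _ _).
- by move=> x y z; apply: sc_inj; exact: addrA.
- by move=> x y; apply: sc_inj; exact: addrC.
- by move=> x; apply: sc_inj; exact: add0r.
- by move=> x; apply: sc_inj; exact: addNr.
- by move=> a b x; apply: sc_inj; exact: scalerA.
- by move=> x; apply: sc_inj; exact: scale1r.
- by move=> a x y; apply: sc_inj; exact: scalerDr.
- by move=> x a b; apply: sc_inj; exact: scalerDl.
- by move=> x y; exact: ler_normD.
- by move=> a x; exact: normrZ.
- by move=> x /normr0_eq0 x0; exact: sc_inj.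
Defined.

Lemma sc_complete (F : set_system sc_normedSpace) :
  ProperFilter F -> cauchy F -> cvg F.
Proof.
move=> FF Fc.
pose f (x : sc_normedSpace) : A := sval x.
have ballE (x y : sc_normedSpace) e : ball (f x) e (f y) = ball x e y.
  by rewrite -!ball_normE.
have fc : cauchy (f @ F).
  apply/cauchy_ballP => e e0.
  move/cauchy_ballP : Fc => /(_ _ e0) [[P Q] /= [FP FQ] PQ].
  exists (f @` P, f @` Q) => /=.
    by split; [apply: filterS FP|apply: filterS FQ] => x Px; exists x.
  move=> [_ _] /= [[x Px <-] [y Qy <-]]; rewrite ballE.
  exact: (PQ (x, y)).
have /(cvg_ex (f @ F)).1 [l fl] := bs_complete (fmap_proper_filter f FF) fc.
have Sl : sc_set S l.
  refine (closed_cvg (sc_set S) (sc_closed S) _ l fl).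
  by apply: nearW => x; exact: svalP.
apply/cvg_ex; exists (exist _ l Sl : sc_normedSpace).
apply/cvg_ballP => e e0; move/cvg_ballP : fl => /(_ _ e0).
by apply: filterS => x /=; rewrite -[l]/(f (exist _ l Sl)) ballE.
Qed.

Definition sc_banachSpace := BanachSpace sc_complete.

Definition sub_cstarAlg : cstarAlg R.
Proof.
refine (@CstarAlg R sc_banachSpace
  (fun x y => exist _ (cmul (sval x) (sval y)) (sc_mul (svalP x) (svalP y)))
  (fun x => exist _ (cstar (sval x)) (sc_star (svalP x))) _ _ _ _ _ _ _ _).
- by move=> x y z; apply: sc_inj; exact: cmulA.
- by move=> z k x y; apply: sc_inj; exact: cmul_linl.
- by move=> z k x y; apply: sc_inj; exact: cmul_linr.
- by move=> x y; exact: cmul_norm.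
- by move=> k x y; apply: sc_inj; exact: cstar_semilin.
- by move=> x; apply: sc_inj; exact: cstarK.
- by move=> x y; apply: sc_inj; exact: cstarM.
- by move=> x; exact: cstar_norm.
Defined.

End SubCstarAlg.

Coercion sub_cstarAlg : subCstar >-> cstarAlg.

Record rep (R : realType) (A : cstarAlg R) := Rep {
  rep_space : hilbertSpace R;
  rep_op :> A -> rep_space -> rep_space;
  rep_op_linear : forall a, linear (rep_op a);
  rep_op_continuous : forall a, continuous (rep_op a);
  rep_linear : forall x, linear (rep_op^~ x);
  repM : forall a b x, rep_op (cmul a b) x = rep_op a (rep_op b x);
  rep_star : forall a x y, hdot (rep_op (cstar a) x) y = hdot x (rep_op a y) }.

Arguments rep_op_linear {R A} r a k x y : rename.
Arguments rep_op_continuous {R A} r a x : rename.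
Arguments rep_linear {R A} r x k a b : rename.
Arguments repM {R A} r a b x : rename.
Arguments rep_star {R A} r a x y : rename.

Section Representations.
Context (R : realType) (A : cstarAlg R).

Definition irreducible (p : rep A) : Prop :=
  (exists a x, p a x <> 0) /\
  forall M : set (rep_space p), linear_subspace M -> closed M ->
    (forall a x, M x -> M (p a x)) -> M = [set 0] \/ M = setT.

Definition unitary_equiv (p q : rep A) : Prop :=
  exists U : rep_space p -> rep_space q,
    [/\ linear U, forall x y, hdot (U x) (U y) = hdot x y,
        forall y, exists x, U x = y & forall a x, U (p a x) = q a (U x)].

Record irrep := Irrep {
  irrep_rep :> rep A;
  irrep_irreducible : irreducible irrep_rep }.

HB.instance Definition _ := gen_eqMixin irrep.
HB.instance Definition _ := gen_choiceMixin irrep.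

Definition irrep_equiv (p q : irrep) : bool := `[< unitary_equiv p q >].

Let irrep_equiv_refl : reflexive irrep_equiv.
Proof. by move=> p; apply/asboolP; exists id; split=> // y; exists y. Qed.

Lemma unitary_equiv_sym (p q : rep A) : unitary_equiv p q -> unitary_equiv q p.
Proof.
move=> [U [Ul Ud Us Ui]].
have [V UV] := choice Us.
have Uinj x y : U x = U y -> x = y.
  move=> Uxy; have Uxy0 : U (x - y) = 0.
    by rewrite -scaleN1r addrC Ul Uxy scaleN1r addNr.
  apply/subr0_eq/normr0_eq0/eqP; rewrite -sqrf_eq0 -hdot_norm -Ud Uxy0.
  by rewrite hdot_norm normr0 expr0n.
exists V; split.
- by move=> k x y; apply: Uinj; rewrite Ul !UV.
- by move=> x y; rewrite -Ud !UV.
- by move=> x; exists (U x); apply: Uinj; rewrite UV.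
- by move=> a x; apply: Uinj; rewrite Ui !UV.
Qed.

Let irrep_equiv_sym : symmetric irrep_equiv.
Proof.
by move=> p q; apply/asboolP/asboolP; exact: unitary_equiv_sym.
Qed.

Let irrep_equiv_trans : transitive irrep_equiv.
Proof.
move=> q p r /asboolP[U [Ul Ud Us Ui]] /asboolP[V [Vl Vd Vs Vi]].
apply/asboolP; exists (V \o U); split=> /=.
- by move=> k x y; rewrite /= Ul Vl.
- by move=> x y; rewrite Vd Ud.
- by move=> z; have [y <-] := Vs z; have [x <-] := Us y; exists x.
- by move=> a x; rewrite Ui Vi.
Qed.

Canonical irrep_equiv_rel :=
  EquivRel irrep_equiv irrep_equiv_refl irrep_equiv_sym irrep_equiv_trans.
Canonical irrep_encModRel := defaultEncModRel irrep_equiv.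

Definition spectrum := {eq_quot irrep_equiv}%qT.
HB.instance Definition _ := Choice.on spectrum.
HB.instance Definition _ := Quotient.on spectrum.

Definition rep_ker (p : rep A) : set A := [set a | forall x, p a x = 0].

Definition prim := {P : set A | exists p : irrep, P = rep_ker p}.
HB.instance Definition _ := gen_eqMixin prim.
HB.instance Definition _ := gen_choiceMixin prim.

(* Hull-kernel topology: the closure of S is the set of the primitive ideals
   containing the intersection of the members of S. *)
Definition hull_kernel (S : set prim) : set prim :=
  [set P | (\bigcap_(Q in S) sval Q) `<=` sval P].

Definition prim_open : set_system prim :=
  [set U | hull_kernel (~` U) `<=` ~` U].

Let repl0 (p : rep A) a : p a 0 = 0.
Proof.
by have := rep_op_linear p a (-1) 0 0; rewrite !scaleN1r !addNr.
Qed.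

Let rep0l (p : rep A) x : p 0 x = 0.
Proof.
by have := rep_linear p x (-1) 0 0; rewrite /= !scaleN1r !addNr.
Qed.

Let closed_rep_ker1 (p : rep A) a : closed [set x | p a x = 0].
Proof.
rewrite (_ : [set x | p a x = 0] = p a @^-1` [set 0]) //.
apply: preimage_closed => [x _|]; first exact: rep_op_continuous.
exact/accessible_closed_set1/hausdorff_accessible/norm_hausdorff.
Qed.

Let prim_prime (p : irrep) (I J : set A) :
  (forall a b, I a -> I (cmul a b)) -> (forall a b, J b -> J (cmul a b)) ->
  I `&` J `<=` rep_ker p ->
  I `<=` rep_ker p \/ J `<=` rep_ker p.
Proof.
move=> Ir Jl IJp.
have [|/existsNP[i /not_implyP[Ii /existsNP[h pih]]]] :=
  pselect (I `<=` rep_ker p); first by left.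
right=> j Jj k; apply: contrapT => pjk.
have [[a [x pax]] irr] := irrep_irreducible p.
pose N := \bigcap_(a in [set: A]) [set v | p (cmul i a) v = 0].
have [| | |N0|NT] := irr N.
- split=> [b _|c u v Nu Nv b _] /=; first exact: repl0.
  by rewrite rep_op_linear Nu // Nv // scaler0 addr0.
- by apply: closed_bigI => b _; exact: closed_rep_ker1.
- by move=> b v Nv c _ /=; rewrite -repM -cmulA; exact: Nv.
- have : N (p j k).
    move=> b _ /=; rewrite -repM; apply: IJp; split; last exact: Jl.
    by rewrite -cmulA; exact: Ir.
  by rewrite N0.
have [| | |M0|MT] := irr [set v | p i v = 0].
- split=> [|c u v /= pu pv] /=; first exact: repl0.
  by rewrite rep_op_linear pu pv scaler0 addr0.
- exact: closed_rep_ker1.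
- move=> b v _ /=; rewrite -repM.
  by have : N v by [rewrite NT]; apply.
- apply: pax; suff : [set v | p i v = 0] (p a x) by rewrite M0.
  by rewrite /= -repM; have : N x by [rewrite NT]; apply.
- by apply: pih; rewrite -[_ = _]/([set v | p i v = 0] h) MT.
Qed.

Let prim_openT : prim_open setT.
Proof.
rewrite /prim_open /= setCT => -[P [p Pp]] /= sub.
have [[a [x pax]] _] := irrep_irreducible p.
by apply: pax; move: (sub a); rewrite /= Pp; apply => -[Q ?] [].
Qed.

Let prim_openI : setI_closed prim_open.
Proof.
move=> U V oU oV; rewrite /prim_open /= setCI => -[P [p Pp]] PUV.
have idl (S : set prim) a b :
    (\bigcap_(Q in S) sval Q) b -> (\bigcap_(Q in S) sval Q) (cmul a b).
  move=> Sb [Q [q Qq]] SQ /=; have := Sb _ SQ; rewrite /= Qq => qb x.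
  by rewrite repM qb repl0.
have idr (S : set prim) a b :
    (\bigcap_(Q in S) sval Q) a -> (\bigcap_(Q in S) sval Q) (cmul a b).
  move=> Sa [Q [q Qq]] SQ /=; have := Sa _ SQ; rewrite /= Qq => qa x.
  by rewrite repM qa.
have [|UP|VP] := @prim_prime p (\bigcap_(Q in ~` U) sval Q)
  (\bigcap_(Q in ~` V) sval Q) (idr _) (idl _) _.
- by rewrite -Pp -bigcap_setU.
- by left; apply: oU; rewrite /hull_kernel /= Pp.
- by right; apply: oV; rewrite /hull_kernel /= Pp.
Qed.

Let prim_open_bigU (T : Type) (U : T -> set prim) :
  (forall i, prim_open (U i)) -> prim_open (\bigcup_i U i).
Proof.
move=> oU P hP [i _ UiP]; apply: (oU i P) UiP => a Ua; apply: hP => Q nQ.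
by apply: Ua => UiQ; apply: nQ; exists i.
Qed.

HB.instance Definition _ :=
  isOpenTopological.Build prim prim_openT prim_openI prim_open_bigU.

Definition spectrum_ker (p : spectrum) : prim :=
  exist _ (rep_ker (repr p)) (ex_intro _ (repr p) erefl).

HB.instance Definition _ :=
  Topological.copy spectrum (initial_topology spectrum_ker).

End Representations.

Section Restriction.
Context (R : realType) (A : cstarAlg R) (J : subCstar A).

Definition rep_res (p : rep A) : rep J.
Proof.
refine (@Rep R J (rep_space p) (fun a => p (sval a)) _ _ _ _ _).
- by move=> a; exact: rep_op_linear.
- by move=> a; exact: rep_op_continuous.
- by move=> x k a b; exact: (rep_linear p x k (sval a) (sval b)).
- by move=> a b x; exact: repM.
- by move=> a x y; exact: rep_star.
Defined.

Definition spectrum_sub : set (spectrum A) :=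
  [set p | exists2 a, sc_set J a & exists x, (repr p : irrep A) a x <> 0].

(* Graph of the restriction map r_J. *)
Definition res_graph (p : spectrum A) (q : spectrum J) : Prop :=
  spectrum_sub p /\ unitary_equiv (repr q : irrep J) (rep_res (repr p : irrep A)).

End Restriction.

(* Elements of different fibers, e.g. of B_{(rs)t} and B_{r(st)}, are compared
   in the total space {t & B_t}. *)
Definition tot (K : numFieldType) (I : Type) (B : I -> banachSpace K) (t : I)
  (x : B t) : {t : I & B t} := existT (fun t => ns_car (B t)) t x.
Arguments tot {K I} B {t} x.

Record fellBundle (R : realType) (G : groupType) := FellBundle {
  fiber :> G -> banachSpace R[i];
  fmul : forall s t, fiber s -> fiber t -> fiber (s * t)%g;
  fstar : forall t, fiber t -> fiber (t^-1)%g;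
  fmulA : forall r s t (x : fiber r) (y : fiber s) (z : fiber t),
    tot fiber (fmul x (fmul y z)) = tot fiber (fmul (fmul x y) z);
  fmul_linl : forall s t (y : fiber t),
    linear (fun x : fiber s => fmul x y);
  fmul_linr : forall s t (x : fiber s),
    linear (fun y : fiber t => fmul x y);
  fmul_norm : forall s t (x : fiber s) (y : fiber t),
    `|fmul x y| <= `|x| * `|y|;
  fstar_semilin : forall t (k : R[i]) (x y : fiber t),
    fstar (k *: x + y) = k^* *: fstar x + fstar y;
  fstarK : forall t (x : fiber t), tot fiber (fstar (fstar x)) = tot fiber x;
  fstarM : forall s t (x : fiber s) (y : fiber t),
    tot fiber (fstar (fmul x y)) = tot fiber (fmul (fstar y) (fstar x));
  fstar_isometry : forall t (x : fiber t), `|fstar x| = `|x|;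
  fstar_norm : forall t (x : fiber t), `|fmul (fstar x) x| = `|x| ^+ 2;
  (* x^* x is positive in the C*-algebra B_e, i.e. of the form c^* c there. *)
  fstar_pos : forall t (x : fiber t), exists c : fiber 1%g,
    tot fiber (fmul (fstar x) x) = tot fiber (fmul (fstar c) c) }.

Section FellBundle.
Context (R : realType) (G : groupType) (B : fellBundle R G).
Local Open Scope group_scope.

Definition fcast (s t : G) (e : s = t) (x : B s) : B t := ecast r (B r) e x.

Lemma tot_fcast s t (e : s = t) (x : B s) : tot B (fcast e x) = tot B x.
Proof. by case: _ / e. Qed.

Lemma tot_inj t : injective (@tot _ _ B t).
Proof.
move=> x y xy; have := projT2_eq xy.
by rewrite (Prop_irrelevance (projT1_eq xy) erefl).
Qed.

Let totM r s r' s' (x : B r) (y : B s) (x' : B r') (y' : B s') :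
  tot B x = tot B x' -> tot B y = tot B y' -> tot B (fmul x y) = tot B (fmul x' y').
Proof.
pose f (u v : {t & B t}) := tot B (fmul (projT2 u) (projT2 v)).
by move=> xx yy; rewrite -[LHS]/(f (tot B x) (tot B y)) xx yy.
Qed.

Let totS r r' (x : B r) (x' : B r') :
  tot B x = tot B x' -> tot B (fstar x) = tot B (fstar x').
Proof.
pose f (u : {t & B t}) := tot B (fstar (projT2 u)).
by move=> xx; rewrite -[LHS]/(f (tot B x)) xx.
Qed.

Let tot_norm r r' (x : B r) (x' : B r') : tot B x = tot B x' -> `|x| = `|x'|.
Proof.
pose f (u : {t & B t}) := `|projT2 u|.
by move=> xx; rewrite -[LHS]/(f (tot B x)) xx.
Qed.

Let fcast_linear s t (e : s = t) : linear (fcast e).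
Proof. by case: _ / e. Qed.

Let fcast_norm s t (e : s = t) (x : B s) : `|fcast e x| = `|x|.
Proof. by case: _ / e. Qed.

Definition unit_mul (a b : B 1) : B 1 := fcast (mulg1 1) (fmul a b).
Definition unit_star (a : B 1) : B 1 := fcast (invg1 G) (fstar a).

Definition unit_fiber : cstarAlg R.
Proof.
refine (@CstarAlg R (B 1) unit_mul unit_star _ _ _ _ _ _ _ _).
- move=> a b c; apply: tot_inj; rewrite !tot_fcast.
  transitivity (tot B (fmul a (fmul b c))); first by apply: totM => //; exact: tot_fcast.
  by rewrite fmulA; apply: totM => //; rewrite tot_fcast.
- by move=> b k x y; rewrite /unit_mul fmul_linl fcast_linear.
- by move=> a k x y; rewrite /unit_mul fmul_linr fcast_linear.
- by move=> a b; rewrite fcast_norm fmul_norm.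
- move=> k a b; rewrite /unit_star fstar_semilin; exact: fcast_linear.
- move=> a; apply: tot_inj; rewrite tot_fcast -[RHS]fstarK.
  by apply: totS; exact: tot_fcast.
- move=> a b; apply: tot_inj; rewrite !tot_fcast.
  transitivity (tot B (fstar (fmul a b))); first by apply: totS; exact: tot_fcast.
  by rewrite fstarM; apply: totM; rewrite tot_fcast.
- move=> a; rewrite fcast_norm -fstar_norm.
  by apply: tot_norm; apply: totM => //; exact: tot_fcast.
Defined.

(* The product XY of subsets of fibers. *)
Definition fiber_prod s t (X : set (B s)) (Y : set (B t)) : set (B (s * t)) :=
  closed_span [set z | exists2 x, X x & exists2 y, Y y & z = fmul x y].

Definition Dset t : set (B 1) :=
  fcast (mulgV t) @` fiber_prod [set: B t] (@fstar R G B t @` [set: B t]).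

Let Dgen t : set (B 1) :=
  [set a | exists x y : B t, tot B a = tot B (fmul x (fstar y))].

Lemma DsetE t : Dset t = closed_span (Dgen t).
Proof.
have castE s r (e : s = r) (S : set (B s)) (T : set (B r)) :
    (forall a, T a <-> exists2 z, S z & fcast e z = a) ->
    fcast e @` closed_span S = closed_span T.
  case: _ / e T => T TS; have -> : T = S.
    by apply/seteqP; split=> [a /TS[z Sz <-]//|a Sa]; apply/TS; exists a.
  by rewrite image_id.
apply: castE => a; split.
  move=> [x [y axy]]; exists (fmul x (fstar y)); last first.
    by apply: tot_inj; rewrite tot_fcast.
  by exists x => //; exists (fstar y) => //; exists y.
by move=> [_ [x _ [_ [y _ <-] ->]] <-]; exists x, y; rewrite tot_fcast.
Qed.

Let Dgen_mul t a b : Dgen t a -> Dgen t b -> Dgen t (unit_mul a b).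
Proof.
move=> [x [y axy]] [z [w bzw]].
exists (fcast (mulgVK t t) (fmul (fmul x (fstar y)) z)), w.
rewrite tot_fcast (totM axy bzw) fmulA; apply: totM => //.
by rewrite tot_fcast.
Qed.

Let Dgen_star t a : Dgen t a -> Dgen t (unit_star a).
Proof.
move=> [x [y axy]]; exists y, x.
by rewrite tot_fcast (totS axy) fstarM; apply: totM => //; exact: fstarK.
Qed.

Let linear_map (V : normedModType R[i]) (f : V -> V) : linear f ->
  [/\ forall u v, f (u + v) = f u + f v, forall k v, f (k *: v) = k *: f v,
      f 0 = 0 & forall u v, f u - f v = f (u - v)].
Proof.
move=> fl.
have fD u v : f (u + v) = f u + f v by rewrite -{1}[u]scale1r fl scale1r.
have f0 : f 0 = 0 by apply: (addrI (f 0)); rewrite -fD !addr0.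
have fZ k v : f (k *: v) = k *: f v by rewrite -[k *: v]addr0 fl f0 addr0.
by split=> // u v; rewrite fD -[in RHS]scaleN1r fZ scaleN1r.
Qed.

Let D_stable t (f : B 1 -> B 1) (M : R[i]) : linear f -> 0 <= M ->
  (forall u, (`|f u| <= M * `|u|)%R) ->
  (forall x, Dgen t x -> closed_span (Dgen t) (f x)) ->
  forall x, closed_span (Dgen t) x -> closed_span (Dgen t) (f x).
Proof.
move=> fl M0 fM fS; have [fD fZ f0 fB] := linear_map fl.
apply: closed_span_image => // [k v|].
  have [C0 Cl] := closed_span_subspace (Dgen t).
  by rewrite fZ -[k *: f v]addr0 => ?; exact: Cl.
by apply: (lipschitz_continuous M0) => u v; rewrite fB.
Qed.

Definition fell_D (t : G) : subCstar unit_fiber.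
Proof.
refine (@SubCstar R unit_fiber (Dset t) _ _ _ _); rewrite DsetE.
- exact: closed_span_subspace.
- exact: closed_closure.
- move=> a b Da Db.
  apply: (D_stable (f := unit_mul a) (M := `|a|)) Db => //.
  + exact: (@cmul_linr R unit_fiber a).
  + by move=> u; exact: (@cmul_norm R unit_fiber).
  move=> {}b Db; apply: (D_stable (f := unit_mul^~ b) (M := `|b|)) Da => //.
  + exact: (@cmul_linl R unit_fiber b).
  + by move=> u; rewrite mulrC; exact: (@cmul_norm R unit_fiber).
  by move=> {}a Da; apply/closed_span_incl/Dgen_mul.
- have starl := @cstar_semilin R unit_fiber.
  have star0 : unit_star 0 = 0.
    by have := starl (-1) 0 0; rewrite rmorphN1 !scaleN1r !addNr.
  have starZ k (v : B 1) : unit_star (k *: v) = k^* *: unit_star v.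
    by have := starl k v 0; rewrite [cstar 0]star0 !addr0.
  have starD (u v : B 1) : unit_star (u + v) = unit_star u + unit_star v.
    by have := starl 1%R u v; rewrite rmorph1 !scale1r.
  have starN (v : B 1) : unit_star (- v) = - unit_star v.
    by have := starZ (-1)%R v; rewrite rmorphN1 !scaleN1r.
  apply: (closed_span_image (f := unit_star)) => // [k v Dv| |x Dx].
  + have [C0 Cl] := closed_span_subspace (Dgen t).
    by rewrite starZ -[_ *: _]addr0; exact: Cl.
  + apply: (lipschitz_continuous (M := 1%R)) => // u v.
    by rewrite -starN -starD fcast_norm fstar_isometry mul1r.
  + exact/closed_span_incl/Dgen_star.
Defined.

(* The right inner product y^* x of B_t. *)
Lemma dip_subproof t (x y : B t) :
  sc_set (fell_D t^-1) (fcast (mulVg t) (fmul (fstar y) x)).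
Proof.
rewrite /= DsetE; apply: closed_span_incl; exists (fstar y), (fstar x).
by rewrite tot_fcast; apply: totM => //; rewrite fstarK.
Qed.

Definition dip t (x y : B t) : fell_D t^-1 := exist _ _ (dip_subproof x y).

Definition lact t (a : fell_D t) (x : B t) : B t := fcast (mul1g t) (fmul (sval a) x).

(* [q] is (a realization of) the representation Ind_{B_t} p: [q] acts on a
   completion of the algebraic tensor product of B_t and the space of [p], for
   the inner product <x (x) h, y (x) k> = <p (y^* x) h, k>.  The map [i] sends
   (x, h) to the class of x (x) h; it is automatically D_{t^-1}-balanced by the
   inner product formula. *)
Definition is_Ind t (p : rep (fell_D t^-1)) (q : rep (fell_D t)) : Prop :=
  exists i : B t -> rep_space p -> rep_space q,
    [/\ (forall h, linear (i^~ h)) /\ (forall x, linear (i x)),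
        forall x y h k, hdot (i x h) (i y k) = hdot (p (dip x y) h) k,
        closed_span [set i x h | x in [set: B t] & h in [set: rep_space p]]
          = [set: rep_space q] &
        forall a x h, q a (i x h) = i (lact a x) h].

(* Graph of the map induced by Ind_{B_t} on the spectra. *)
Definition Ind_graph t (p : spectrum (fell_D t^-1)) (q : spectrum (fell_D t)) : Prop :=
  is_Ind (repr p : irrep (fell_D t^-1)) (repr q : irrep (fell_D t)).

Definition fell_X t : set (spectrum unit_fiber) := spectrum_sub (fell_D t).

(* Graph of r_t^-1 \o Ind_{B_t} \o r_{t^-1}. *)
Definition alpha_hat t (p q : spectrum unit_fiber) : Prop :=
  exists p' q', [/\ @res_graph _ _ (fell_D t^-1) p p', Ind_graph p' q' &
                    @res_graph _ _ (fell_D t) q q'].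

End FellBundle.

(* The partial map with graph [r] is a homeomorphism from [U] onto [V]. *)
Definition homeomorphism_graph (T : topologicalType) (U V : set T)
    (r : T -> T -> Prop) : Prop :=
  exists f g : T -> T,
    [/\ forall x y, r x y <-> U x /\ y = f x,
        forall x, U x -> V (f x) /\ g (f x) = x,
        forall y, V y -> U (g y) /\ f (g y) = y,
        {within U, continuous f} & {within V, continuous g}].

(* Partial maps are given by their graphs: [theta t x y] means that x is in the
   domain of theta_t and y = theta_t x. *)
Record partial_action (G : groupType) (T : topologicalType) (U : G -> set T)
    (theta : G -> T -> T -> Prop) : Prop := PartialAction {
  pa_open : forall t, open (U t);
  pa_homeo : forall t, homeomorphism_graph (U t^-1%g) (U t) (theta t);
  pa_dom1 : U 1%g = setT;
  pa_map1 : forall x y, theta 1%g x y <-> y = x;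
  pa_comp : forall s t x y z,
    theta t x y -> theta s y z -> theta (s * t)%g x z }.

(* Main.v *)
From HB Require Import structures.
Require Import Defs.
From mathcomp Require Import all_boot all_order all_algebra.
From mathcomp Require Import complex ring.
From mathcomp Require Import all_classical all_reals all_analysis.

Set Implicit Arguments.
Unset Strict Implicit.
Unset Printing Implicit Defensive.

Import Order.TTheory GRing.Theory Num.Theory.
Import numFieldNormedType.Exports.

Local Open Scope classical_set_scope.
Local Open Scope ring_scope.

(** Write [A] for the unit fiber.  The relation [induces t p q] says that [q] is
    the representation of the whole algebra [A] on [B_t (x) H_p] by left
    multiplication.  An irreducible representation which does not vanish on an
    ideal has an irreducible restriction to it, and the restriction determines
    the representation; so restricting, inducing from [D_{t^-1}] to [D_t] and
    extending amounts to inducing directly from [A] to [A] ([alpha_hatP]), and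
    after that the ideals only say where the maps are defined.

    The group law is the isometry
    [x (x) (y (x) h) |-> xy (x) h] of [B_s (x) (B_t (x) H_p)] into
    [B_st (x) H_p].  It intertwines the actions of [A], and it is onto although
    [B_s B_t] may be smaller than [B_st], because its range is a nonzero closed
    invariant subspace of an irreducible representation ([induces_comp]).  As
    [A (x) H_p] is [H_p] ([induces_unit]), inducing along [t] and then
    along [t^-1] is the identity, which gives the inverse maps.  The open
    sets of the spectrum are the sets of the classes that do not vanish on some
    given set [E]; the induced representation vanishes on [E] exactly when [p]
    vanishes on [B_t^* E B_t] ([induces_ker]), so the maps are continuous.

    It remains to construct [B_t (x) H_p] and to see that it is irreducible.
    As every nonzero vector [h0] of [H_p] is cyclic, the tensor product is the
    completion of [B_t] for [<p(y^* x) h0, h0>], whose positivity is the axiom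
    that [x^* x] is positive in [A].  The completion is realized as a Hilbert
    space of functions with a reproducing kernel, on which the action and the
    vectors [x (x) h] are given by formulas.  Irreducibility
    ([induces_irreducible]) comes from the identity
    [z (x) (x (x) -)^* m = q(z x^* ) m].  All operators are bounded by a single
    estimate ([action_bound]) for actions of [A] by adjointable operators. *)

(** * Semi-inner products *)

Record semidot (R : realType) (V : lmodType R[i]) := Semidot {
  sdot :> V -> V -> R[i];
  sdot_linear : forall y, scalar (sdot^~ y);
  sdot_conj : forall x y, sdot x y = (sdot y x)^*;
  sdot_ge0 : forall x, 0 <= sdot x x }.

Section Semidot.
Context (R : realType) (V : lmodType R[i]) (s : semidot V).

Lemma sdotDl x x' y : s (x + x') y = s x y + s x' y.
Proof. by have := sdot_linear s y 1 x x'; rewrite scale1r mul1r. Qed.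

Lemma sdot0l y : s 0 y = 0.
Proof. by apply: (addrI (s 0 y)); rewrite -sdotDl !addr0. Qed.

Lemma sdotZl k x y : s (k *: x) y = k * s x y.
Proof. by have := sdot_linear s y k x 0; rewrite !addr0 sdot0l addr0. Qed.

Lemma sdotNl x y : s (- x) y = - s x y.
Proof. by rewrite -scaleN1r sdotZl mulN1r. Qed.

Lemma sdotBl x x' y : s (x - x') y = s x y - s x' y.
Proof. by rewrite sdotDl sdotNl. Qed.

Lemma sdotDr x y y' : s x (y + y') = s x y + s x y'.
Proof. by rewrite sdot_conj sdotDl rmorphD /= -!(sdot_conj s x). Qed.

Lemma sdot0r x : s x 0 = 0.
Proof. by rewrite sdot_conj sdot0l rmorph0. Qed.

Lemma sdotZr k x y : s x (k *: y) = k^* * s x y.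
Proof. by rewrite sdot_conj sdotZl rmorphM /= -sdot_conj. Qed.

Lemma sdotNr x y : s x (- y) = - s x y.
Proof. by rewrite -scaleN1r sdotZr rmorphN1 mulN1r. Qed.

Lemma sdotBr x y y' : s x (y - y') = s x y - s x y'.
Proof. by rewrite sdotDr sdotNr. Qed.

Definition snorm x : R[i] := sqrtC (s x x).

Lemma snorm_ge0 x : 0 <= snorm x.
Proof. by rewrite sqrtC_ge0 sdot_ge0. Qed.

Lemma snorm_sqr x : snorm x ^+ 2 = s x x.
Proof. exact: sqrtCK. Qed.

Lemma snorm_le x k : 0 <= k -> s x x <= k ^+ 2 -> snorm x <= k.
Proof. by move=> k0; rewrite -snorm_sqr ler_pXn2r ?nnegrE// snorm_ge0. Qed.

(** Expanding [s (x - c y) (x - c y) >= 0] at [c = s x y / d] with [d] any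
    number larger than [s y y] avoids a separate treatment of the vectors of
    norm zero; letting [d] tend to [s y y] gives the inequality. *)
Lemma cauchy_schwarz x y : `|s x y| <= snorm x * snorm y.
Proof.
rewrite -(@ler_pXn2r _ 2)// ?nnegrE ?mulr_ge0 ?snorm_ge0//.
rewrite exprMn !snorm_sqr.
set a := s x x; set b := s y y; set z := s x y.
have a0 : 0 <= a by exact: sdot_ge0.
have b0 : 0 <= b by exact: sdot_ge0.
have key (e : R[i]) : 0 < e -> `|z| ^+ 2 <= a * (b + e).
  move=> e0; set d := b + e; have d0 : 0 < d by rewrite ltr_wpDl.
  rewrite -ler_pdivrMr//.
  have dr : (d^-1)^* = d^-1 by apply/CrealP; rewrite rpredV realE ltW.
  have := sdot_ge0 s (x - (z / d) *: y).
  rewrite sdotBl !sdotBr !sdotZl !sdotZr -/a -/b -/z.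
  rewrite (sdot_conj s y x) -/z rmorphM /= dr.
  have -> : a - z^* / d * z - (z / d * z^* - z / d * (z^* / d * b))
      = a - `|z| ^+ 2 / d - `|z| ^+ 2 / d * (1 - b / d).
    by rewrite normCK; field; rewrite gt_eqF.
  rewrite -addrA -opprD subr_ge0; apply: le_trans.
  rewrite lerDl mulr_ge0// ?divr_ge0 ?exprn_ge0 ?(ltW d0)//.
  by rewrite subr_ge0 ler_pdivrMr// mul1r lerDl ltW.
apply/ler_addgt0Pr => e e0.
have a1 : 0 < a + 1 by rewrite ltr_wpDl.
apply: (le_trans (key (e / (a + 1)) _)); first by rewrite divr_gt0.
rewrite mulrDr lerD2l mulrCA ler_piMr ?(ltW e0)//.
by rewrite ler_pdivrMr// mul1r lerDl.
Qed.

Lemma snormD x y : snorm (x + y) <= snorm x + snorm y.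
Proof.
apply: snorm_le; first by rewrite addr_ge0// snorm_ge0.
rewrite sdotDl !sdotDr sqrrD !snorm_sqr addrA -[_ *+ 2]addr0.
have -> : s x x + s x y + s y x + s y y = s x x + (s x y + s y x) + s y y.
  by rewrite !addrA.
rewrite addr0 lerD2r lerD2l.
have re : s x y + s y x \is Num.real.
  by apply/CrealP; rewrite rmorphD /= -!sdot_conj addrC.
apply: (le_trans (real_ler_norm re)); apply: (le_trans (ler_normD _ _)).
rewrite mulr2n lerD//; first exact: cauchy_schwarz.
by rewrite mulrC; exact: cauchy_schwarz.
Qed.

Lemma snormZ k x : snorm (k *: x) = `|k| * snorm x.
Proof.
apply/eqP; rewrite -(@eqrXn2 _ 2)// ?mulr_ge0 ?snorm_ge0//.
by rewrite exprMn !snorm_sqr normCK sdotZl sdotZr mulrA.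
Qed.

End Semidot.

Lemma eq_of_sqr (R : realType) (a b : R[i]) :
  0 <= a -> 0 <= b -> a ^+ 2 = b ^+ 2 -> a = b.
Proof. by move=> a0 b0 /eqP; rewrite eqrXn2// => /eqP. Qed.

Section Hilbert.
Context (R : realType) (H : hilbertSpace R).

Lemma hdot_ge0 x : 0 <= hdot (x : H) x.
Proof. by rewrite hdot_norm exprn_ge0. Qed.

Definition hdot_semidot : semidot (hs_space H) :=
  Semidot (@hdot_linear R H) (@hdot_conj R H) hdot_ge0.

Lemma hdot_snorm (x : H) : snorm hdot_semidot x = `|x|.
Proof.
by apply/eq_of_sqr; rewrite ?snorm_ge0// snorm_sqr /= hdot_norm.
Qed.

Lemma hdot_le (x y : H) : `|hdot x y| <= `|x| * `|y|.
Proof. by rewrite -!hdot_snorm; exact: cauchy_schwarz. Qed.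

Lemma hdot_eq0 (x : H) : hdot x x = 0 -> x = 0.
Proof.
by rewrite hdot_norm => /eqP; rewrite expf_eq0 /= normr_eq0 => /eqP.
Qed.

End Hilbert.

(** * Limits of complex numbers *)

Lemma complex_gt0 (R : realType) (e : R[i]) : 0 < e ->
  exists2 r : R, 0 < r & e = r%:C%C.
Proof.
case: e => a b; rewrite ltcE /= => /andP[/eqP -> a0]; by exists a.
Qed.

Lemma invn_small (R : realType) (e : R[i]) : 0 < e ->
  exists N, forall n, (N <= n)%N -> n.+1%:R^-1 <= e.
Proof.
move=> /complex_gt0[r r0 ->]; exists (Num.trunc r^-1) => n Nn.
rewrite -(rmorph_nat (real_complex R)) -fmorphV lecR -[leRHS]invrK.
rewrite lef_pV2 ?posrE ?invr_gt0 ?ltr0n//.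
by apply: (le_trans (ltW (truncnS_gt _))); rewrite ler_nat ltnS.
Qed.

Section CauchySequences.
Context (K : numFieldType) (V : normedModType K).

Lemma cauchy_seq (u : nat -> V) :
  (forall e, 0 < e -> exists N, forall n, (N <= n)%N -> `|u n - u N| <= e) ->
  cauchy (u @ \oo).
Proof.
move=> uC; apply: cauchy_exP => e e0.
have [N uN] := uC (e / 2) (divr_gt0 e0 (ltr0Sn _ _)).
exists (u N); exists N => // n /= Nn; rewrite -ball_normE /= distrC.
by rewrite (le_lt_trans (uN n Nn))// ltr_pdivrMr// ltr_pMr// ltr1n.
Qed.

Lemma cvg_seqP (u : nat -> V) (l : V) : u @ \oo --> l <->
  forall e, 0 < e -> exists N, forall n, (N <= n)%N -> `|u n - l| <= e.
Proof.
split=> [/cvgrPdist_le ul e e0|ul].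
  by have [N _ uN] := ul e e0; exists N => n Nn; rewrite distrC; exact: uN.
apply/cvgrPdist_le => e e0; have [N uN] := ul e e0.
by exists N => // n Nn; rewrite /= distrC; exact: uN.
Qed.

End CauchySequences.

Section ComplexLimits.
Context (R : realType).

(** The real and imaginary parts are Lipschitz, so they map a Cauchy filter to
    Cauchy filters of real numbers. *)
Lemma complex_complete (F : set_system R[i]^o) :
  ProperFilter F -> cauchy F -> cvg F.
Proof.
move=> FF Fc.
have lip (f : R[i] -> R) : (forall x y, `|f x - f y|%:C%C <= `|x - y|) ->
    cvg (f @ F).
  move=> fl; apply: cauchy_cvg; apply: cauchy_exP => e e0.
  have [x Fx] : exists x, F (ball x e%:C%C).
    by have /cauchyP := Fc; apply; rewrite ltcR.
  exists (f x); rewrite /nbhs /=; apply: (@filterS _ F _ _ _ _ Fx) => y.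
  rewrite -!ball_normE /= => xy.
  by rewrite -ltcR; apply: le_lt_trans (fl x y) xy.
have reB x y : complex.Re (x - y) = complex.Re x - complex.Re y :> R.
  by case: x y => ? ? [].
have imB x y : complex.Im (x - y) = complex.Im x - complex.Im y :> R.
  by case: x y => ? ? [].
have re_le z : `|complex.Re z|%:C%C <= `|z| :> R[i] by exact: normc_ge_Re.
have im_le z : `|complex.Im z|%:C%C <= `|z| :> R[i].
  by rewrite normc_def lecR -sqrtr_sqr ler_wsqrtr// lerDr sqr_ge0.
have /(cvg_ex (_ @ F)).1[a Fa] := lip (@complex.Re R) (fun x y =>
  eq_ind _ (fun t => `|t|%:C%C <= _) (re_le _) _ (reB x y)).
have /(cvg_ex (_ @ F)).1[b Fb] := lip (@complex.Im R) (fun x y =>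
  eq_ind _ (fun t => `|t|%:C%C <= _) (im_le _) _ (imB x y)).
apply/(cvg_ex F); exists (a +i* b)%C.
apply/cvgrPdist_le => e /complex_gt0[r r0 ->].
have r2 : 0 < r / 2 by rewrite divr_gt0.
move/cvgrPdist_le : Fa => /(_ _ r2) Fa; move/cvgrPdist_le : Fb => /(_ _ r2) Fb.
apply: (@filterS2 _ F _ _ _ _ _ Fa Fb) => z /= az bz.
rewrite [_ - _]complexE reB imB /=.
apply: (le_trans (ler_normD _ _)).
rewrite normrM normCi mul1r !normc_def /= !expr0n !addr0 !sqrtr_sqr.
rewrite -rmorphD lecR.
by rewrite [leRHS](splitr r) lerD.
Qed.

Lemma complex_cauchy_cvg (u : nat -> R[i]^o) :
  (forall e, 0 < e -> exists N, forall n, (N <= n)%N -> `|u n - u N| <= e) ->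
  exists l : R[i]^o, u @ \oo --> l.
Proof.
move=> /cauchy_seq uC; apply/(cvg_ex (u @ \oo)); exact: complex_complete.
Qed.

Lemma cvg_conjC (u : nat -> R[i]^o) (l : R[i]^o) : u @ \oo --> l ->
  (fun n => (u n)^* : R[i]^o) @ \oo --> (l^* : R[i]^o).
Proof.
move=> /cvg_seqP ul; apply/cvg_seqP => e /ul[N uN]; exists N => n /uN.
by rewrite -rmorphB norm_conjC.
Qed.

Lemma cvg_ge0 (u : nat -> R[i]^o) (l : R[i]^o) :
  u @ \oo --> l -> (forall n, 0 <= u n) -> 0 <= l.
Proof.
move=> /cvg_seqP ul u0.
suff -> : l = `|l| by [].
apply/eqP; rewrite -subr_eq0 -normr_le0.
apply/ler_addgt0Pr => e e0; rewrite add0r.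
have [N /(_ N (leqnn _)) uN] := ul (e / 2) (divr_gt0 e0 (ltr0Sn _ _)).
have -> : l - `|l| = (l - u N) + (`|u N| - `|l|).
  by rewrite (ger0_norm (u0 N)) addrA subrK.
rewrite (le_trans (ler_normD _ _))// [leRHS]splitr lerD//.
  by rewrite distrC.
exact: le_trans (ler_dist_dist _ _) uN.
Qed.

Lemma cvg_invn (u : nat -> R[i]^o) (l : R[i]^o) (C : R[i]) : 0 <= C ->
  (forall n, `|u n - l| <= C * n.+1%:R^-1) -> u @ \oo --> l.
Proof.
move=> C0 uC; apply/cvg_seqP => e e0; have C1 : 0 < C + 1 by rewrite ltr_wpDl.
have [N eN] := invn_small (divr_gt0 e0 C1); exists N => n /eN {}eN.
apply: (le_trans (uC n)); rewrite -(divfK (lt0r_neq0 C1) e) mulrC.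
by rewrite ler_pM// lerDl.
Qed.

End ComplexLimits.

(** * Square roots and automatic boundedness *)

Section Cstar.
Context (R : realType) (A : cstarAlg R).
Implicit Types a b c z : A.

Lemma cmulDl a b c : cmul (a + b) c = cmul a c + cmul b c.
Proof. by have := cmul_linl c 1 a b; rewrite !scale1r. Qed.

Lemma cmulDr a b c : cmul c (a + b) = cmul c a + cmul c b.
Proof. by have := cmul_linr c 1 a b; rewrite !scale1r. Qed.

Lemma cmul0l c : cmul 0 c = 0.
Proof. by apply: (addrI (cmul 0 c)); rewrite -cmulDl !addr0. Qed.

Lemma cmul0r c : cmul c 0 = 0.
Proof. by apply: (addrI (cmul c 0)); rewrite -cmulDr !addr0. Qed.

Lemma cmulZl k a c : cmul (k *: a) c = k *: cmul a c.
Proof. by have := cmul_linl c k a 0; rewrite !addr0 cmul0l addr0. Qed.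

Lemma cmulZr k a c : cmul c (k *: a) = k *: cmul c a.
Proof. by have := cmul_linr c k a 0; rewrite !addr0 cmul0r addr0. Qed.

Lemma cmulBl a b c : cmul (a - b) c = cmul a c - cmul b c.
Proof. by rewrite cmulDl -scaleN1r cmulZl scaleN1r. Qed.

Lemma cmulBr a b c : cmul c (a - b) = cmul c a - cmul c b.
Proof. by rewrite cmulDr -scaleN1r cmulZr scaleN1r. Qed.

Lemma cstarD a b : cstar (a + b) = cstar a + cstar b.
Proof. by have := cstar_semilin 1 a b; rewrite rmorph1 !scale1r. Qed.

Lemma cstar0 : cstar 0 = 0 :> A.
Proof. by apply: (addrI (cstar 0)); rewrite -cstarD !addr0. Qed.

Lemma cstarZ k a : cstar (k *: a) = k^* *: cstar a.
Proof. by have := cstar_semilin k a 0; rewrite !addr0 cstar0 addr0. Qed.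

Lemma cstarB a b : cstar (a - b) = cstar a - cstar b.
Proof. by rewrite cstarD -scaleN1r cstarZ rmorphN1 scaleN1r. Qed.

Lemma cstar_isometry a : `|cstar a| = `|a|.
Proof.
have le (c : A) : `|c| <= `|cstar c|.
  have [->|c0] := eqVneq c 0; first by rewrite normr0 normr_ge0.
  have n0 : 0 < `|c| by rewrite normr_gt0.
  by rewrite -(ler_pM2r n0) -expr2 -cstar_norm cmul_norm.
by apply/le_anti; rewrite le andbT; have := le (cstar a); rewrite cstarK.
Qed.

(** [z] is a fixed point of [z |-> (b + z ^ 2) / 2], a contraction of the ball
    of radius [1/2].  In a unital algebra [1 - z] would be a square root
    of [1 - b]. *)
Lemma one_minus_sqrt b : cstar b = b -> `|b| <= 3 / 4 ->
  exists2 z, cstar z = z & z + z - cmul z z = b.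
Proof.
move=> bs b34.
pose u n := iter n (fun z => 2^-1 *: (b + cmul z z)) (0 : A).
have uS n : u n.+1 = 2^-1 *: (b + cmul (u n) (u n)) by [].
have us n : cstar (u n) = u n.
  elim: n => [|n IH]; first exact: cstar0.
  by rewrite uS cstarZ cstarD cstarM IH bs fmorphV /= rmorph_nat.
have h0 : 0 <= 2^-1 :> R[i] by [].
have u2 n : `|u n| <= 2^-1.
  elim: n => [|n IH]; first by rewrite normr0.
  rewrite uS normrZ ger0_norm// ler_piMr// (le_trans (ler_normD _ _))//.
  have -> : 1 = 3 / 4 + 2^-1 * 2^-1 :> R[i] by field.
  by rewrite lerD// (le_trans (cmul_norm _ _))// ler_pM.
have sq (x y : A) : `|cmul x x - cmul y y| <= (`|x| + `|y|) * `|x - y|.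
  have -> : cmul x x - cmul y y = cmul x (x - y) + cmul (x - y) y.
    by rewrite cmulBr cmulBl addrA subrK.
  rewrite (le_trans (ler_normD _ _))// mulrDl lerD ?cmul_norm//.
  by rewrite mulrC cmul_norm.
have step n : `|u n.+1 - u n| <= 2^-1 ^+ n.
  elim: n => [|n IH].
    by rewrite subr0 expr0 (le_trans (u2 1%N))// invf_le1// ler1n.
  rewrite [u n.+2]uS [X in _ - X]uS -scalerBr opprD addrACA subrr add0r.
  rewrite normrZ ger0_norm// exprS ler_wpM2l//.
  rewrite (le_trans (sq _ _))// -[leRHS]mul1r ler_pM ?addr_ge0//.
  have -> : 1 = 2^-1 + 2^-1 :> R[i] by field.
  exact: lerD.
have tail n k : `|u (n + k)%N - u n| <= 2 * 2^-1 ^+ n.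
  suff : `|u (n + k)%N - u n| <= 2 * 2^-1 ^+ n - 2 * 2^-1 ^+ (n + k).
    by move/le_trans; apply; rewrite gerBl mulr_ge0 ?exprn_ge0.
  elim: k => [|k IH]; first by rewrite addn0 !subrr normr0.
  rewrite addnS -(subrK (u (n + k)%N) (u _)) -addrA.
  rewrite (le_trans (ler_normD _ _))//.
  have -> : 2 * 2^-1 ^+ n - 2 * 2^-1 ^+ (n + k).+1
      = 2^-1 ^+ (n + k) + (2 * 2^-1 ^+ n - 2 * 2^-1 ^+ (n + k)) :> R[i].
    by rewrite (exprS _ (n + k)); field.
  by rewrite lerD.
have [z uz] : exists z : A, u @ \oo --> z.
  apply/(cvg_ex (u @ \oo)); apply: bs_complete; apply: cauchy_seq => e e0.
  have [N eN] := invn_small (divr_gt0 e0 (ltr0Sn R[i] 1)).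
  exists N => n Nn; rewrite -(subnKC Nn) (le_trans (tail _ _))//.
  rewrite -ler_pdivlMl// mulrC; apply: le_trans (eN N _) => //.
  rewrite exprVn lef_pV2 ?posrE ?exprn_gt0 ?ltr0n// -natrX ler_nat.
  exact: ltn_expl.
have z2 : `|z| <= 2^-1 + 2^-1.
  move/cvg_seqP : uz => /(_ 2^-1) [] // N /(_ N (leqnn _)) uNz.
  by rewrite -(subrK (u N) z) (le_trans (ler_normD _ _))// lerD// distrC.
have uSz : (fun n => u n.+1) @ \oo --> z by rewrite (cvg_shiftS u).
have uuz : (fun n => cmul (u n) (u n)) @ \oo --> cmul z z.
  apply/cvg_seqP => e e0.
  move/cvg_seqP : uz => /(_ (e / 2) (divr_gt0 e0 (ltr0Sn _ _))) [N uN].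
  exists N => n /uN {}uN; rewrite (le_trans (sq _ _))// mulrC.
  rewrite -(divfK (_ : 2 != 0) e) ?pnatr_eq0// ler_pM ?addr_ge0//.
  have -> : 2 = 2^-1 + (2^-1 + 2^-1 + 2^-1) :> R[i] by field.
  rewrite lerD// (le_trans z2)// lerDl//.
exists z.
  apply: (@cvg_unique _ (@norm_hausdorff _ A) (u @ \oo)) => //.
  have sc : continuous (@cstar R A).
    apply: (@lipschitz_continuous _ A A _ 1) => // x y.
    by rewrite -cstarB cstar_isometry mul1r.
  rewrite (_ : u = @cstar R A \o u); first exact: cvg_comp uz (sc z).
  by apply/funext => n /=; rewrite us.
have : (fun n => u n.+1 + u n.+1 - cmul (u n) (u n)) @ \oo
    --> z + z - cmul z z by exact: cvgB (cvgD uSz uSz) uuz.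
rewrite (_ : (fun n => _) = cst b); last first.
  apply/funext => n; rewrite /cst uS -scalerDl.
  by rewrite (_ : 2^-1 + 2^-1 = 1) ?scale1r ?addrK//; field.
move=> /(@cvg_unique _ (@norm_hausdorff _ A) (cst b @ \oo)); apply.
exact: cvg_cst.
Qed.

(** When [z] is as in [one_minus_sqrt] for [b], the number
    [s x x - s (b x) x = s (x - z x) (x - z x)] is nonnegative.  Taking for [b]
    a multiple of [a^* a] bounds the operator of [a]; the constant [2] is not
    optimal, it leaves room for the bound [3/4] on the norm of [b]. *)
Lemma action_bound (V : lmodType R[i]) (s : semidot V) (act : A -> V -> V) :
  (forall k a b x, act (k *: a + b) x = k *: act a x + act b x) ->
  (forall a b x, act (cmul a b) x = act a (act b x)) ->
  (forall a x y, s (act a x) y = s x (act (cstar a) y)) ->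
  forall a x, snorm s (act a x) <= 2 * `|a| * snorm s x.
Proof.
move=> actL actM actS a x.
have act0 y : act 0 y = 0.
  by have := actL (-1) 0 0 y; rewrite scaler0 addr0 scaleN1r addNr.
have actZ k c y : act (k *: c) y = k *: act c y.
  by have := actL k c 0 y; rewrite !addr0 act0 addr0.
have actD c d y : act (c + d) y = act c y + act d y.
  by have := actL 1 c d y; rewrite !scale1r.
have actN c y : act (- c) y = - act c y by rewrite -[- c]scaleN1r actZ scaleN1r.
have [->|a0] := eqVneq a 0.
  by rewrite act0 normr0 mulr0 mul0r snorm_le// sdot0l expr0n.
have n0 : 0 < 2 * `|a| by rewrite mulr_gt0// normr_gt0.
set k := (2 * `|a|)^-1; have k0 : 0 < k by rewrite invr_gt0.
have kr : k^* = k by apply/CrealP; rewrite realE ltW.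
suff : snorm s (act (k *: a) x) <= snorm s x.
  by rewrite actZ snormZ (gtr0_norm k0) ler_pdivrMl.
pose b := cmul (cstar (k *: a)) (k *: a).
have bs : cstar b = b by rewrite /b cstarM cstarK.
have [|z zs zb] := one_minus_sqrt bs.
  rewrite cstar_norm normrZ (gtr0_norm k0) /k invfM -mulrA mulVf ?normr_eq0//.
  rewrite mulr1 -subr_ge0 (_ : _ - _ = 2^-1)//; first by field.
apply: snorm_le; first exact: snorm_ge0.
rewrite !snorm_sqr actS -actM -/b -zb actD actD actN actM -subr_ge0.
have := sdot_ge0 s (x - act z x).
rewrite sdotBl !sdotBr !actS !zs !(sdotDr, sdotNr).
by rewrite !opprD !opprK !addrA.
Qed.

End Cstar.

(** * Dense sets and bounded extension *)

Lemma linear_mapD (K : numFieldType) (V W : lmodType K) (f : V -> W) :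
  linear f -> {morph f : x y / x + y}.
Proof. by move=> fl x y; have := fl 1 x y; rewrite !scale1r. Qed.

Lemma linear_map0 (K : numFieldType) (V W : lmodType K) (f : V -> W) :
  linear f -> f 0 = 0.
Proof. by move=> fl; apply: (addrI (f 0)); rewrite -linear_mapD// !addr0. Qed.

Lemma linear_mapZ (K : numFieldType) (V W : lmodType K) (f : V -> W) k x :
  linear f -> f (k *: x) = k *: f x.
Proof. by move=> fl; have := fl k x 0; rewrite !addr0 linear_map0// addr0. Qed.

Lemma linear_mapB (K : numFieldType) (V W : lmodType K) (f : V -> W) :
  linear f -> {morph f : x y / x - y}.
Proof.
by move=> fl x y; rewrite linear_mapD// -scaleN1r linear_mapZ// scaleN1r.
Qed.

Lemma linear_le_continuous (K : numFieldType) (V W : normedModType K)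
    (f : V -> W) (M : K) :
  linear f -> 0 <= M -> (forall x, `|f x| <= M * `|x|) -> continuous f.
Proof.
move=> fl M0 fM; apply: (lipschitz_continuous M0) => x y.
by rewrite -linear_mapB.
Qed.

Lemma dense_ind (K : numFieldType) (V : normedModType K) (S P : set V) :
  closed_span S = setT -> linear_subspace P -> closed P -> S `<=` P ->
  forall v, P v.
Proof.
move=> ST Pl Pc SP v; have : closed_span S v by rewrite ST.
rewrite ((closure_id P).1 Pc); apply: closureS; exact: linear_span_sub.
Qed.

Lemma closed_equalizer (K : numFieldType) (V : topologicalType)
    (W : normedModType K) (f g : V -> W) :
  continuous f -> continuous g -> closed [set v | f v = g v].
Proof.
move=> fc gc; rewrite (_ : [set v | _] = (fun v => f v - g v) @^-1` [set 0]).
  apply: preimage_closed => [v _|].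
    by apply: cvgB; [exact: fc|exact: gc].
  exact/accessible_closed_set1/hausdorff_accessible/norm_hausdorff.
apply/seteqP; split=> v /=; first by move=> ->; rewrite subrr.
by move=> /eqP; rewrite subr_eq0 => /eqP.
Qed.

Lemma dense_eq_linear (K : numFieldType) (V W : normedModType K) (S : set V)
    (f g : V -> W) :
  closed_span S = setT -> linear f -> linear g ->
  continuous f -> continuous g ->
  (forall v, S v -> f v = g v) -> f =1 g.
Proof.
move=> ST fl gl fc gc fg; apply: (dense_ind ST) => //.
  split=> [|k x y /= fgx fgy]; first by rewrite /= !linear_map0.
  by rewrite fl gl fgx fgy.
exact: closed_equalizer.
Qed.

Lemma linear_subspace_scale (K : numFieldType) (V : lmodType K) (S : set V)
    k x : linear_subspace S -> S x -> S (k *: x).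
Proof. by move=> [S0 Sl] Sx; rewrite -[_ *: _]addr0; exact: Sl. Qed.

Lemma linear_range (K : numFieldType) (V W : lmodType K) (U : V -> W) :
  linear U -> linear_subspace (range U).
Proof.
move=> Ul; split; first by exists 0 => //; exact: linear_map0.
by move=> k _ _ [x _ <-] [y _ <-]; exists (k *: x + y); rewrite ?Ul.
Qed.

Section HilbertDense.
Context (R : realType) (H : hilbertSpace R).
Implicit Types x y : H.

Lemma hdot_continuous y : continuous ((fun x : H => hdot x y) : H -> R[i]^o).
Proof.
apply: (@linear_le_continuous _ H (R[i]^o) _ `|y|) => //.
  by move=> k u v; exact: (hdot_linear y k u v).
by move=> x; rewrite mulrC; exact: hdot_le.
Qed.

Lemma hdotBl (x y z : H) : hdot (x - y) z = hdot x z - hdot y z.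
Proof. exact: (sdotBl (hdot_semidot H)). Qed.

Lemma hdotBr (x y z : H) : hdot z (x - y) = hdot z x - hdot z y.
Proof. exact: (sdotBr (hdot_semidot H)). Qed.

Lemma dense_orthogonal (S : set H) x : closed_span S = setT ->
  (forall z, S z -> hdot z x = 0) -> x = 0.
Proof.
move=> ST xS; apply: hdot_eq0.
apply: (dense_ind (P := [set z | hdot z x = 0]) ST) => //.
  split=> [|k u v /= ux vx]; first exact: (sdot0l (hdot_semidot H)).
  by rewrite [LHS](hdot_linear x) ux vx mulr0 addr0.
apply: (@closed_equalizer _ H (R[i]^o) (fun z => hdot z x) (cst 0)).
  exact: hdot_continuous.
exact: cst_continuous.
Qed.

Lemma hdot_dense_eq (S : set H) x y : closed_span S = setT ->
  (forall z, S z -> hdot z x = hdot z y) -> x = y.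
Proof.
move=> ST xy; apply/subr0_eq/(dense_orthogonal ST) => z Sz.
by rewrite hdotBr xy// subrr.
Qed.

End HilbertDense.

(** A bounded linear map on a dense subspace is given by its graph [G], which
    makes maps defined on a spanning family, without a choice of coefficients,
    as easy as maps defined on vectors: the bound on [G] is what makes them well
    defined.  The extension is the closure of [G]. *)
Section BoundedExtension.
Context (R : realType) (V W : banachSpace R[i]).
Variables (G : set (V * W)) (C : R[i]).
Hypotheses (Gl : linear_subspace G) (C0 : 0 <= C).
Hypothesis GC : forall g, G g -> `|g.2| <= C * `|g.1|.
Hypothesis Gd : closure (fst @` G) = setT.

Let adh (x : V) (y : W) :=
  forall e, 0 < e -> exists2 g, G g & `|x - g.1| <= e /\ `|y - g.2| <= e.

Let adh_lin k x y x' y' :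
  adh x y -> adh x' y' -> adh (k *: x + x') (k *: y + y').
Proof.
move=> xy xy' e e0.
have k1 : 0 < `|k| + 1 by rewrite ltr_wpDl.
have [g Gg [xg yg]] := xy _ (divr_gt0 e0 k1).
have [g' Gg' [xg' yg']] := xy' _ (divr_gt0 e0 k1).
exists (k *: g + g'); first exact: Gl.2.
have le (U : normedSpace R[i]) (u u' v v' : U) : `|u - v| <= e / (`|k| + 1) ->
    `|u' - v'| <= e / (`|k| + 1) -> `|k *: u + u' - (k *: v + v')| <= e.
  move=> uv uv'; rewrite opprD addrACA -scalerBr (le_trans (ler_normD _ _))//.
  rewrite normrZ -[leRHS](divfK (lt0r_neq0 k1)) mulrDr mulr1 lerD//.
  by rewrite mulrC ler_wpM2r.
by split; exact: le.
Qed.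

Let adh_bound x y : adh x y -> `|y| <= C * `|x|.
Proof.
move=> xy; apply/ler_addgt0Pr => e e0.
have C1 : 0 < C + 1 by rewrite ltr_wpDl.
have [g Gg [xg yg]] := xy _ (divr_gt0 e0 C1).
rewrite -(subrK g.2 y) (le_trans (ler_normD _ _))//.
apply: (le_trans (lerD yg (GC Gg))).
have : `|g.1| <= `|x| + e / (C + 1).
  by rewrite -[g.1](subKr x) (le_trans (ler_normB _ _))// lerD2l.
move=> /(ler_wpM2l C0) /(lerD (lexx (e / (C + 1)))) /le_trans; apply.
rewrite mulrDr addrCA lerD2l -{1}[e / _]mul1r -mulrDl mulrC [1 + C]addrC.
by rewrite divfK // lt0r_neq0.
Qed.

Let adh_ex x : exists y, adh x y.
Proof.
have nG n : exists g, G g /\ `|x - g.1| <= n.+1%:R^-1.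
  have : closure (fst @` G) x by rewrite Gd.
  move=> /(_ (ball x n.+1%:R^-1)) [|_ [[g Gg <-]]].
    by apply: nbhsx_ballx; rewrite invr_gt0.
  by rewrite -ball_normE /= => /ltW; exists g.
have [g /all_and2[Gg xg]] := choice nG.
have GB i j : G (g i - g j).
  by have := Gl.2 (-1) _ _ (Gg j) (Gg i); rewrite scaleN1r addrC.
have dist i j : `|(g i).2 - (g j).2| <= C * (i.+1%:R^-1 + j.+1%:R^-1).
  rewrite (le_trans (GC (GB i j)))//= ler_wpM2l//.
  rewrite -(subrK x (g i).1) -addrA (le_trans (ler_normD _ _))// lerD//.
  by rewrite distrC.
have C1 : 0 < 2 * C + 1 by rewrite ltr_wpDl// mulr_ge0.
have [y gy] : exists y : W, (fun n => (g n).2) @ \oo --> y.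
  apply/(cvg_ex ((fun n => (g n).2) @ \oo)); apply: bs_complete.
  apply: cauchy_seq => e e0; have [N eN] := invn_small (divr_gt0 e0 C1).
  exists N => n Nn; rewrite (le_trans (dist _ _))//.
  have := lerD (eN n Nn) (eN N (leqnn N)) => /(ler_wpM2l C0) /le_trans; apply.
  rewrite (_ : C * _ = e * (2 * C / (2 * C + 1))).
    rewrite ler_piMr ?(ltW e0)//.
    by rewrite ler_pdivrMr// mul1r lerDl.
  by field; rewrite lt0r_neq0.
exists y => e e0; have [N eN] := invn_small e0.
move/cvg_seqP : gy => /(_ e e0)[M yM].
exists (g (maxn N M)) => //; split.
  by rewrite (le_trans (xg _))// eN// leq_maxl.
by rewrite distrC yM// leq_maxr.
Qed.

Lemma bounded_extension : exists T : V -> W, [/\ linear T,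
  forall x, `|T x| <= C * `|x| & forall g, G g -> T g.1 = g.2].
Proof.
have [T xT] := choice adh_ex; exists T.
have uniq x y : adh x y -> T x = y.
  move=> xy; apply/subr0_eq/normr0_eq0/le_anti; rewrite normr_ge0 andbT.
  have := adh_bound (adh_lin (-1) xy (xT x)).
  by rewrite !scaleN1r addNr normr0 mulr0 addrC.
split=> [k x y|x|g Gg]; first exact/uniq/adh_lin.
- exact: adh_bound.
- by apply: uniq => e e0; exists g => //; rewrite !subrr !normr0 ltW.
Qed.

End BoundedExtension.

Section Isometries.
Context (R : realType) (H K : hilbertSpace R).

Lemma isometry_norm (U : H -> K) : (forall x y, hdot (U x) (U y) = hdot x y) ->
  forall x, `|U x| = `|x|.
Proof. by move=> Ud x; apply: eq_of_sqr; rewrite // -!hdot_norm Ud. Qed.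

Lemma isometry_continuous (U : H -> K) : linear U ->
  (forall x y, hdot (U x) (U y) = hdot x y) -> continuous U.
Proof.
move=> Ul Ud; apply: (linear_le_continuous (M := 1) Ul) => // x.
by rewrite mul1r isometry_norm.
Qed.

Lemma isometry_extension (I : Type) (u : I -> H) (v : I -> K) :
  (forall i j, hdot (v i) (v j) = hdot (u i) (u j)) ->
  closed_span (range u) = setT ->
  exists U : H -> K, [/\ linear U, forall x y, hdot (U x) (U y) = hdot x y &
    forall i, U (u i) = v i].
Proof.
move=> uv uT; pose G := linear_span (range (fun i => (u i, v i) : H * K)).
have Gl : linear_subspace G := @linear_span_subspace _ _ _.
have Gdot g g' : G g -> G g' -> hdot g.2 g'.2 = hdot g.1 g'.1.
  move=> Gg; move: g'; apply: linear_span_sub.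
    split=> [|k x y xg yg]; first by
      rewrite [LHS](sdot0r (hdot_semidot K)) [RHS](sdot0r (hdot_semidot H)).
    rewrite [LHS](sdotDr (hdot_semidot K)) [RHS](sdotDr (hdot_semidot H)).
    rewrite [X in X + _](sdotZr (hdot_semidot K)).
    rewrite [X in _ = X + _](sdotZr (hdot_semidot H)).
    by move: xg yg => /= -> ->.
  move=> _ [j _ <-]; move: g Gg; apply: linear_span_sub.
    split=> [|k x y xg yg]; first by
      rewrite [LHS](sdot0l (hdot_semidot K)) [RHS](sdot0l (hdot_semidot H)).
    rewrite [LHS](sdotDl (hdot_semidot K)) [RHS](sdotDl (hdot_semidot H)).
    rewrite [X in X + _](sdotZl (hdot_semidot K)).
    rewrite [X in _ = X + _](sdotZl (hdot_semidot H)).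
    by move: xg yg => /= -> ->.
  by move=> _ [i _ <-] /=.
have [||U [Ul U1 UG]] := @bounded_extension R H K G 1 Gl ler01.
- move=> g Gg; rewrite mul1r.
  by rewrite -(@ler_pXn2r _ 2)// ?nnegrE// -!hdot_norm Gdot.
- apply/seteqP; split=> // x _; have : closed_span (range u) x by rewrite uT.
  apply: closureS; apply: linear_span_sub.
    split; first by exists 0 => //; exact: Gl.1.
    move=> k _ _ [g Gg <-] [g' Gg' <-]; exists (k *: g + g') => //.
    exact: Gl.2.
  move=> _ [i _ <-]; exists (u i, v i) => //.
  by apply: linear_span_incl; exists i.
have Uu i : U (u i) = v i.
  by apply: (UG (u i, v i)); apply: linear_span_incl; exists i.
exists U; split=> //; have Uc := linear_le_continuous Ul ler01 U1.
have half w y : (forall i, hdot (U (u i)) w = hdot (u i) y) ->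
    forall x, hdot (U x) w = hdot x y.
  move=> wy; apply: (@dense_eq_linear _ H (R[i]^o) _
      (fun x => hdot (U x) w) (fun x => hdot x y) uT).
  - by move=> k x x'; rewrite Ul; exact: (hdot_linear w).
  - by move=> k x x'; exact: (hdot_linear y).
  - move=> x; apply: (@continuous_comp _ _ (R[i]^o) U (fun z => hdot z w)).
      exact: Uc.
    exact: hdot_continuous.
  - exact: hdot_continuous.
  - by move=> _ [i _ <-].
move=> x y; apply: (half) => i; rewrite hdot_conj [RHS]hdot_conj; congr (_^*).
by rewrite Uu; apply: half => j; rewrite !Uu.
Qed.

(** The preimages of a convergent sequence of values form a Cauchy sequence. *)
Lemma isometry_range_closed (U : H -> K) : linear U ->
  (forall x y, hdot (U x) (U y) = hdot x y) -> closed (range U).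
Proof.
move=> Ul Ud y yU.
have near_y n : exists x, `|y - U x| <= n.+1%:R^-1.
  have [|_ [[x _ <-]]] := yU (ball y n.+1%:R^-1).
    by apply: nbhsx_ballx; rewrite invr_gt0.
  by rewrite -ball_normE /= => /ltW; exists x.
have [x xy] := choice near_y.
have [z xz] : exists z : H, x @ \oo --> z.
  apply/(cvg_ex (x @ \oo)); apply: bs_complete; apply: cauchy_seq => e e0.
  have [N eN] := invn_small (divr_gt0 e0 (ltr0Sn R[i] 1)).
  exists N => n Nn; rewrite -(isometry_norm Ud) (linear_mapB Ul).
  rewrite -(subrK y (U (x n))) -addrA (le_trans (ler_normD _ _))//.
  rewrite [leRHS]splitr lerD//; last exact: (le_trans (xy N) (eN N (leqnn N))).
  by rewrite distrC (le_trans (xy n))// eN.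
exists z => //; apply: (@cvg_unique _ (@norm_hausdorff _ K) (U \o x @ \oo)).
  apply: cvg_comp xz _; exact: isometry_continuous.
apply/cvg_seqP => e /invn_small[N eN]; exists N => n /eN; apply: le_trans.
by rewrite distrC; exact: xy.
Qed.

Lemma isometry_surjective (U : H -> K) (S : set K) : linear U ->
  (forall x y, hdot (U x) (U y) = hdot x y) -> closed_span S = setT ->
  S `<=` range U -> forall y, exists x, U x = y.
Proof.
move=> Ul Ud ST SU y.
have [x _ <-] :=
  dense_ind ST (linear_range Ul) (isometry_range_closed Ul Ud) SU y.
by exists x.
Qed.

End Isometries.

(** * Completion of a semi-inner product space *)

Lemma cvg_normC (R : realType) (u : nat -> R[i]^o) (l : R[i]^o) :
  u @ \oo --> l ->
  (fun n => `|u n| : R[i]^o) @ \oo --> (`|l| : R[i]^o).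
Proof.
move=> /cvg_seqP ul; apply/cvg_seqP => e /ul[N uN]; exists N => n /uN.
exact: le_trans (ler_dist_dist _ _).
Qed.

Lemma cvg_ext (R : realType) (u v : nat -> R[i]^o) (l : R[i]^o) :
  u =1 v -> u @ \oo --> l -> v @ \oo --> l.
Proof. by move=> /funext ->. Qed.

(** The completion of [V] is realized by the functions [f] on [V] that can be
    approximated by the functions [s x -], uniformly with respect to the
    seminorm.  Vectors at distance zero give the same function, so no quotient
    is needed, and the vector space operations are those of functions. *)
Section Completion.
Context (R : realType) (V : normedSpace R[i]) (s : semidot V).
Local Notation d n := (n.+1%:R^-1 : R[i]).

Definition approximates (f : V -> R[i]) (x : V) (e : R[i]) :=
  forall y, `|f y - s x y| <= e * snorm s y.

Definition approximable (f : V -> R[i]) :=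
  forall e, 0 < e -> exists x, approximates f x e.

Definition completion_car := {f : V -> R[i] | approximable f}.
Implicit Types f g h : completion_car.

Local Notation ev f := (sval (f : completion_car)).

Lemma completion_ext f g : ev f =1 ev g -> f = g.
Proof.
by case: f g => [f af] [g ag] /= /funext fg; exact: eq_exist.
Qed.

(** Bound [s w w], for [w = x - x'], by evaluating both approximations
    at [w]. *)
Lemma approx_dist (f : V -> R[i]) x x' a b : 0 <= a -> 0 <= b ->
  approximates f x a -> approximates f x' b -> snorm s (x - x') <= a + b.
Proof.
move=> a0 b0 fx fx'; have [n0|n0] := eqVneq (snorm s (x - x')) 0.
  by rewrite n0 addr_ge0.
have np : 0 < snorm s (x - x') by rewrite lt_def n0 snorm_ge0.
rewrite -(ler_pM2r np) -expr2 snorm_sqr -(ger0_norm (sdot_ge0 s _)).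
set w := x - x' in np *.
have -> : s w w = (f w - s x' w) - (f w - s x w).
  by rewrite [f w - _]addrC opprB [s x w - _]addrC addrA addrK addrC -sdotBl.
by apply: (le_trans (ler_normB _ _)); rewrite mulrDl [leRHS]addrC lerD.
Qed.

Lemma approximable0 : approximable (fun=> 0).
Proof.
move=> e e0; exists 0 => y; rewrite sdot0l subrr normr0 mulr_ge0 ?snorm_ge0//.
exact: ltW.
Qed.

Lemma approximableP (k : R[i]) f g :
  approximable (fun y => k * ev f y + ev g y).
Proof.
move=> e e0; have k1 : 0 < `|k| + 1 by rewrite ltr_wpDl.
have [x fx] := svalP f _ (divr_gt0 e0 k1).
have [x' gx'] := svalP g _ (divr_gt0 e0 k1).
exists (k *: x + x') => y; rewrite sdotDl sdotZl opprD addrACA -mulrBr.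
rewrite (le_trans (ler_normD _ _))// normrM.
rewrite (_ : e * _ = `|k| * (e / (`|k| + 1) * snorm s y)
  + e / (`|k| + 1) * snorm s y); last by field; rewrite lt0r_neq0.
by rewrite lerD// ler_wpM2l.
Qed.

Let mk (k : R[i]) f g : completion_car := exist _ _ (approximableP k f g).
Let czero : completion_car := exist _ _ approximable0.
Let cadd f g : completion_car := mk 1 f g.
Let cscale k f : completion_car := mk k f czero.
Let copp f : completion_car := cscale (-1) f.

Let caddE f g y : ev (cadd f g) y = ev f y + ev g y.
Proof. by rewrite /= mul1r. Qed.

Let cscaleE k f y : ev (cscale k f) y = k * ev f y.
Proof. by rewrite /= addr0. Qed.

Let coppE f y : ev (copp f) y = - ev f y.
Proof. by rewrite cscaleE mulN1r. Qed.

Let caddA : associative cadd.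
Proof. by move=> f g h; apply: completion_ext => y; rewrite !caddE addrA. Qed.

Let caddC : commutative cadd.
Proof. by move=> f g; apply: completion_ext => y; rewrite !caddE addrC. Qed.

Let cadd0 : left_id czero cadd.
Proof. by move=> f; apply: completion_ext => y; rewrite !caddE add0r. Qed.

Let caddN : left_inverse czero copp cadd.
Proof. by move=> f; apply: completion_ext => y; rewrite !caddE coppE addNr. Qed.

Let cscaleA a b f : cscale a (cscale b f) = cscale (a * b) f.
Proof. by apply: completion_ext => y; rewrite !cscaleE mulrA. Qed.

Let cscale1 : left_id 1 cscale.
Proof. by move=> f; apply: completion_ext => y; rewrite !cscaleE mul1r. Qed.

Let cscaleDr : right_distributive cscale cadd.
Proof.
by move=> k f g; apply: completion_ext => y; rewrite !(cscaleE, caddE) mulrDr.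
Qed.

Let cscaleDl f : {morph cscale^~ f : a b / a + b >-> cadd a b}.
Proof.
by move=> a b; apply: completion_ext => y; rewrite !(cscaleE, caddE) mulrDl.
Qed.

HB.instance Definition _ := gen_eqMixin completion_car.
HB.instance Definition _ := gen_choiceMixin completion_car.
HB.instance Definition _ := GRing.isZmodule.Build completion_car
  caddA caddC cadd0 caddN.
HB.instance Definition _ := GRing.Zmodule_isLmodule.Build R[i] completion_car
  cscaleA cscale1 cscaleDr cscaleDl.

Lemma completion_linE k f g y : ev (k *: f + g) y = k * ev f y + ev g y.
Proof. by rewrite [LHS]caddE cscaleE. Qed.

Lemma approximant_ex f n : exists x, approximates (ev f) x (d n).
Proof. by apply: (svalP f); rewrite invr_gt0. Qed.

Definition approximant f n : V := projT1 (cid (approximant_ex f n)).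

Lemma approximantP f n : approximates (ev f) (approximant f n) (d n).
Proof. exact: projT2 (cid (approximant_ex f n)). Qed.

Let d_le1 n : d n <= 1.
Proof. by rewrite invf_le1 ?ltr0n// ler1n. Qed.

Lemma approximant_dist f n m :
  snorm s (approximant f n - approximant f m) <= d n + d m.
Proof. by apply: (approx_dist (f := ev f)) => //; exact: approximantP. Qed.

Lemma approximant_bounded f : exists2 M, 0 <= M &
  forall n, snorm s (approximant f n) <= M.
Proof.
exists (2 + snorm s (approximant f 0)); first by rewrite addr_ge0// snorm_ge0.
move=> n; rewrite -(subrK (approximant f 0) (approximant f n)).
rewrite (le_trans (snormD _ _ _))// lerD2r.
rewrite (le_trans (approximant_dist _ _ _))//.
by rewrite -[2]/(1 + 1) lerD.
Qed.

Let cdot_cauchy f g : exists l : R[i]^o,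
  (fun n => s (approximant f n) (approximant g n) : R[i]^o) @ \oo --> l.
Proof.
apply: complex_cauchy_cvg => e e0.
have [M M0 fM] := approximant_bounded f.
have [M' M'0 gM'] := approximant_bounded g.
have M1 : 0 < 2 * (M + M') + 1 by rewrite ltr_wpDl// mulr_ge0// addr_ge0.
have [N eN] := invn_small (divr_gt0 e0 M1); exists N => n Nn.
set x := approximant f; set y := approximant g.
have -> : s (x n) (y n) - s (x N) (y N) =
    s (x n - x N) (y n) + s (x N) (y n - y N).
  by rewrite sdotBl sdotBr addrA subrK.
rewrite (le_trans (ler_normD _ _))//.
rewrite (le_trans (lerD (cauchy_schwarz _ _ _) (cauchy_schwarz _ _ _)))//.
have le2 h : snorm s (approximant h n - approximant h N)
    <= 2 * (e / (2 * (M + M') + 1)).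
  rewrite (le_trans (approximant_dist _ _ _))// mulr_natl mulr2n lerD//.
    exact: eN.
  exact: eN.
apply: (le_trans (lerD (ler_pM _ _ (le2 f) (gM' n))
                       (ler_pM _ _ (fM N) (le2 g))));
  rewrite ?snorm_ge0//.
set c := _ + 1 in M1 *.
have -> : 2 * (e / c) * M' + M * (2 * (e / c)) = e * ((c - 1) / c).
  by rewrite /c addrK; field; rewrite lt0r_neq0.
by rewrite ler_piMr ?(ltW e0)// ler_pdivrMr// mul1r gerBl.
Qed.

Definition cdot f g : R[i] := projT1 (cid (cdot_cauchy f g)).

Lemma cdot_cvg f g :
  (fun n => s (approximant f n) (approximant g n) : R[i]^o) @ \oo
    --> (cdot f g : R[i]^o).
Proof. exact: projT2 (cid (cdot_cauchy f g)). Qed.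
Arguments cdot_cvg : clear implicits.

Lemma cdot_cvg_ev f g :
  (fun n => ev f (approximant g n) : R[i]^o) @ \oo --> (cdot f g : R[i]^o).
Proof.
have [M M0 gM] := approximant_bounded g.
have h : (fun n => ev f (approximant g n)
    - s (approximant f n) (approximant g n) : R[i]^o) @ \oo --> (0 : R[i]^o).
  apply: (cvg_invn M0) => n; rewrite subr0 (le_trans (approximantP _ _ _))//.
  by rewrite mulrC ler_wpM2r.
rewrite -[cdot f g]add0r; apply: (cvg_ext _ (cvgD h (cdot_cvg f g))) => n.
by rewrite -[LHS]/(_ - _ + _) subrK.
Qed.

Arguments cdot_cvg_ev : clear implicits.

Let uniq (u : nat -> R[i]^o) (a b : R[i]^o) :
  u @ \oo --> a -> u @ \oo --> b -> a = b.
Proof. exact: (@cvg_unique _ (@norm_hausdorff _ (R[i]^o)) (u @ \oo)). Qed.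

Let cdot_linear g : scalar (cdot^~ g).
Proof.
move=> k f f'; apply: (uniq (cdot_cvg_ev (k *: f + f') g)).
have H := cvgD (cvgZl_tmp (k := k) (cdot_cvg_ev f g)) (cdot_cvg_ev f' g).
apply: (cvg_ext _ (H _ _)) => n.
by rewrite completion_linE.
Qed.

Let cdot_conj f g : cdot f g = (cdot g f)^*.
Proof.
apply: (uniq (@cdot_cvg _ _)).
apply: (cvg_ext _ (cvg_conjC (cdot_cvg g f))) => n.
by rewrite /= -sdot_conj.
Qed.

Let cdot_ge0 f : 0 <= cdot f f.
Proof. by apply: (cvg_ge0 (cdot_cvg f f)) => n; exact: sdot_ge0. Qed.

Definition completion_dot : semidot completion_car :=
  Semidot cdot_linear cdot_conj cdot_ge0.

Local Notation N := (snorm completion_dot).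

Lemma approximable_sdot x : approximable (s x).
Proof.
by move=> e e0; exists x => y; rewrite subrr normr0 mulr_ge0 ?snorm_ge0 ?ltW.
Qed.

Definition embed x : completion_car := exist _ (s x) (approximable_sdot x).

Lemma reproducing f x : cdot f (embed x) = ev f x.
Proof.
apply: (uniq (@cdot_cvg _ _)).
have [M M0 fM] := approximant_bounded f.
apply: (cvg_invn (addr_ge0 M0 (snorm_ge0 s x))) => n.
have -> : s (approximant f n) (approximant (embed x) n) - ev f x
   = s (approximant f n) (approximant (embed x) n - x)
     - (ev f x - s (approximant f n) x).
  by rewrite sdotBr opprB addrA subrK.
rewrite (le_trans (ler_normB _ _))// mulrDl lerD//; last first.
  by rewrite mulrC; exact: approximantP.
rewrite (le_trans (cauchy_schwarz _ _ _))// ler_pM ?snorm_ge0//.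
rewrite -[d n]addr0; apply: (approx_dist (f := s x)) => //.
  exact: (@approximantP (embed x) n).
by move=> y; rewrite subrr normr0 mul0r.
Qed.

Lemma ev_le f x : `|ev f x| <= N f * snorm s x.
Proof.
rewrite -reproducing; apply: (le_trans (cauchy_schwarz completion_dot _ _)).
rewrite ler_wpM2l ?snorm_ge0// snorm_le ?snorm_ge0// snorm_sqr.
by rewrite [completion_dot _ _]reproducing.
Qed.

(** The square of the norm of [f] is the limit both of [f x_n] and of
    [s x_n x_n], where [x_n] are approximants of [f]; the bound is passed to the
    limit in the form [|f x_n| <= (s x_n x_n + e ^ 2) / 2], in which no square
    root appears. *)
Lemma completion_norm_le f e : 0 <= e ->
  (forall y, `|ev f y| <= e * snorm s y) -> N f <= e.
Proof.
move=> e0 fe; apply: snorm_le => //.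
have h2 : 0 <= 2^-1 :> R[i] by [].
have amgm n : `|ev f (approximant f n)| <=
    2^-1 * (s (approximant f n) (approximant f n) + e ^+ 2).
  apply: (le_trans (fe _)); rewrite -snorm_sqr -subr_ge0.
  set t := snorm _ _.
  have -> : 2^-1 * (t ^+ 2 + e ^+ 2) - e * t = 2^-1 * (t - e) ^+ 2 by field.
  rewrite mulr_ge0// -realEsqr rpredB// realE ?snorm_ge0 ?e0//.
have H := cvgB (cvgZl_tmp (k := 2^-1) (cvgD (cdot_cvg f f)
  (cvg_cst (e ^+ 2 : R[i]^o)))) (cvg_normC (cdot_cvg_ev f f)).
have : 0 <= 2^-1 * (cdot f f + e ^+ 2) - `|cdot f f|.
  apply: (cvg_ge0 (H _ _ _ _)) => n.
  by rewrite -[X in 0 <= X]/(2^-1 * (_ + _) - `|_|) subr_ge0.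
rewrite ger0_norm//; have -> : 2^-1 * (cdot f f + e ^+ 2) - cdot f f
   = 2^-1 * (e ^+ 2 - cdot f f) by field.
by rewrite pmulr_rge0 ?subr_ge0// invr_gt0.
Qed.

Lemma completion_norm0 f : N f = 0 -> f = 0.
Proof.
move=> f0; apply: completion_ext => y; apply/normr0_eq0/le_anti.
by rewrite normr_ge0 andbT (le_trans (ev_le f y))// f0 mul0r.
Qed.

Definition completion_normedSpace : normedSpace R[i] :=
  @NormedSpace R[i] completion_car 0 -%R +%R *:%R N
    (@addrA _) (@addrC _) (@add0r _) (@addNr _) (@scalerA _ _) (@scale1r _ _)
    (@scalerDr _ _) (@scalerDl _ _) (@snormD _ _ _) (@snormZ _ _ _)
    completion_norm0.

Let evB f g y : ev (f - g) y = ev f y - ev g y.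
Proof.
by rewrite -[f - g]/(f + - g) -scaleN1r addrC completion_linE mulN1r addrC.
Qed.

(** A Cauchy filter converges pointwise, by completeness of the scalars, and
    [completion_norm_le] turns the pointwise estimates into norm estimates. *)
Lemma completion_complete (F : set_system completion_normedSpace) :
  ProperFilter F -> cauchy F -> cvg F.
Proof.
move=> FF Fc.
have Fball (e : R[i]) : 0 < e -> exists f0, F [set f | N (f0 - f) <= e].
  move=> e0; have /cauchyP := Fc; move=> /(_ _ e0)[f0 Ff0].
  exists f0; apply: filterS Ff0 => f; rewrite -ball_normE /= => /ltW; exact.
have evF y : exists l : R[i]^o, (fun f => ev f y : R[i]^o) @ F --> l.
  apply/(cvg_ex (_ @ F)); apply: complex_complete; apply: cauchy_exP => e e0.
  have y1 : 0 < snorm s y + 1 by rewrite ltr_wpDl// snorm_ge0.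
  have [f0 Ff0] := Fball _ (divr_gt0 e0 y1); exists (ev f0 y).
  rewrite /nbhs /=; apply: (@filterS _ F _ _ _ _ Ff0) => f /= f0f.
  rewrite -ball_normE /= -evB (le_lt_trans (ev_le _ _))//.
  apply: (le_lt_trans (ler_wpM2r (snorm_ge0 _ _) f0f)).
  by rewrite mulrAC ltr_pdivrMr// ltr_pM2l// ltrDl.
have [phi phiF] := choice evF.
have phi_near e : 0 < e ->
    exists2 f0, F [set f | N (f0 - f) <= e] &
      forall y, `|ev f0 y - phi y| <= e * snorm s y.
  move=> e0; have [f0 Ff0] := Fball _ e0; exists f0 => // y.
  apply/ler_addgt0Pr => r r0; have /cvgrPdist_le := phiF y => /(_ _ r0) Fr.
  have [f [/= f0f fr]] := filter_ex (filterI Ff0 Fr).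
  rewrite -(subrK (ev f y) (ev f0 y)) -addrA (le_trans (ler_normD _ _))//.
  rewrite lerD//; last by rewrite distrC.
  by rewrite -evB (le_trans (ev_le _ _))// ler_wpM2r// snorm_ge0.
have phi_appr : approximable phi.
  move=> e e0; have e2 : 0 < e / 2 by rewrite divr_gt0.
  have [f0 _ f0phi] := phi_near _ e2; have [x f0x] := svalP f0 _ e2.
  exists x => y; rewrite -(subrK (ev f0 y) (phi y)) -addrA.
  rewrite (le_trans (ler_normD _ _))// [e in leRHS]splitr mulrDl lerD//.
  by rewrite distrC.
pose g : completion_normedSpace := exist _ phi phi_appr.
apply/(cvg_ex F); exists g; apply/cvgrPdist_le => e e0.
have e2 : 0 < e / 2 by rewrite divr_gt0.
have [f0 Ff0 f0phi] := phi_near _ e2; apply: filterS Ff0 => f /= f0f.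
rewrite -(subrK f0 g) -addrA (le_trans (ler_normD _ _))// [leRHS]splitr lerD//.
apply: completion_norm_le; first exact: ltW.
by move=> y; rewrite evB distrC.
Qed.

Definition completion : hilbertSpace R :=
  @HilbertSpace R (BanachSpace completion_complete) cdot
    (sdot_linear completion_dot) (sdot_conj completion_dot)
    (fun f => esym (snorm_sqr completion_dot f)).

Lemma completion_dense : closed_span (range (embed : V -> completion)) = setT.
Proof.
apply/seteqP; split=> // f _; apply: closureS (@linear_span_incl _ _ _) _ _.
move=> U /nbhs_ballP[e /= e0 eU].
have [x fx] := svalP (f : completion_car) _ (divr_gt0 e0 (ltr0Sn R[i] 1)).
exists (embed x); split; first by exists x.
apply: eU; rewrite -ball_normE /=.
apply: (@le_lt_trans _ _ (e / 2)).
  apply: completion_norm_le; first by rewrite divr_ge0// ltW.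
  by move=> y; rewrite evB.
by rewrite ltr_pdivrMr// ltr_pMr// ltr1n.
Qed.

End Completion.

(** * The operations of a Fell bundle on one fiber *)

Section FellOperations.
Context (R : realType) (G : groupType) (B : fellBundle R G).
Local Notation A := (unit_fiber B).
Local Notation total := {t : G & B t}.

(** In the total space the operations are associative and involutive without
    transport along equalities in [G], so identities between elements of the
    fibers are proved there, by [tot_inj] and [totE]. *)
Definition tmul (u v : total) : total := tot B (fmul (projT2 u) (projT2 v)).
Definition tstar (u : total) : total := tot B (fstar (projT2 u)).

Lemma tmulA : associative tmul.
Proof. by move=> [r x] [s y] [t z]; exact: fmulA. Qed.

Lemma tstarK : involutive tstar.
Proof. by move=> [t x]; exact: fstarK. Qed.

Lemma tstarM u v : tstar (tmul u v) = tmul (tstar v) (tstar u).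
Proof. by case: u v => [s x] [t y]; exact: fstarM. Qed.

Lemma tot_fmul s t (x : B s) (y : B t) :
  tot B (fmul x y) = tmul (tot B x) (tot B y).
Proof. by []. Qed.

Lemma tot_fstar t (x : B t) : tot B (fstar x) = tstar (tot B x).
Proof. by []. Qed.

Section Fiber.
Variable t : G.
Implicit Types (a b : A) (x y z : B t).

Definition lmul a x : B t := fcast (mul1g t) (fmul (a : B 1%g) x).
Definition rmul x a : B t := fcast (mulg1 t) (fmul x (a : B 1%g)).
Definition ip x y : A := fcast (mulVg t) (fmul (fstar y) x).
Definition outer x y : A := fcast (mulgV t) (fmul x (fstar y)).

Lemma tot_lmul a x : tot B (lmul a x) = tmul (tot B (a : B 1%g)) (tot B x).
Proof. by rewrite /lmul tot_fcast. Qed.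

Lemma tot_rmul x a : tot B (rmul x a) = tmul (tot B x) (tot B (a : B 1%g)).
Proof. by rewrite /rmul tot_fcast. Qed.

Lemma tot_ip x y : tot B (ip x y : B 1%g) = tmul (tstar (tot B y)) (tot B x).
Proof. by rewrite /ip tot_fcast. Qed.

Lemma tot_outer x y :
  tot B (outer x y : B 1%g) = tmul (tot B x) (tstar (tot B y)).
Proof. by rewrite /outer tot_fcast. Qed.

End Fiber.

Lemma tot_cmul (a b : A) : tot B (cmul a b : B 1%g) =
  tmul (tot B (a : B 1%g)) (tot B (b : B 1%g)).
Proof. exact: tot_fcast. Qed.

Lemma tot_cstar (a : A) : tot B (cstar a : B 1%g) = tstar (tot B (a : B 1%g)).
Proof. exact: tot_fcast. Qed.

Definition totE := (tot_lmul, tot_rmul, tot_ip, tot_outer, tot_cmul, tot_cstar,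
  tot_fmul, tot_fstar, tot_fcast).

Lemma lmulM t (a b : A) (x : B t) : lmul (cmul a b) x = lmul a (lmul b x).
Proof. by apply: tot_inj; rewrite !totE tmulA. Qed.

Lemma ip_lmul t (a : A) (x y : B t) : ip (lmul a x) y = ip x (lmul (cstar a) y).
Proof. by apply: tot_inj; rewrite !totE tstarM tstarK tmulA. Qed.

Lemma ip_rmull t (b : A) (x y : B t) : ip (rmul x b) y = cmul (ip x y) b.
Proof. by apply: tot_inj; rewrite !totE tmulA. Qed.

Lemma ip_rmulr t (b : A) (x y : B t) :
  ip x (rmul y b) = cmul (cstar b) (ip x y).
Proof. by apply: tot_inj; rewrite !totE tstarM tmulA. Qed.

Lemma cstar_ip t (x y : B t) : cstar (ip x y) = ip y x.
Proof. by apply: tot_inj; rewrite !totE tstarM tstarK. Qed.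

Lemma lmul_outer t (x y z : B t) : lmul (outer x y) z = rmul x (ip z y).
Proof. by apply: tot_inj; rewrite !totE tmulA. Qed.

Lemma ip_fmul s t (x x' : B s) (y y' : B t) :
  ip (fmul x y) (fmul x' y') = ip (lmul (ip x x') y) y'.
Proof. by apply: tot_inj; rewrite !totE tstarM !tmulA. Qed.

Lemma lmul_fmul s t (a : A) (x : B s) (y : B t) :
  lmul a (fmul x y) = fmul (lmul a x) y.
Proof. by apply: tot_inj; rewrite !totE tmulA. Qed.

Lemma cmul_outer t (a : A) (x y : B t) :
  cmul a (outer x y) = outer (lmul a x) y.
Proof. by apply: tot_inj; rewrite !totE tmulA. Qed.

Lemma outer_cmul t (a : A) (x y : B t) :
  cmul (outer x y) a = outer x (lmul (cstar a) y).
Proof. by apply: tot_inj; rewrite !totE tstarM tstarK tmulA. Qed.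

Lemma ip_unit (x y : A) : ip (x : B 1%g) (y : B 1%g) = cmul (cstar y) x.
Proof. by apply: tot_inj; rewrite !totE. Qed.

Lemma lmul_unit (a x : A) : lmul a (x : B 1%g) = cmul a x.
Proof. by apply: tot_inj; rewrite !totE. Qed.

Lemma ip_pos t (x : B t) : exists c : A, ip x x = cmul (cstar c) c.
Proof.
have [c xc] := fstar_pos x; exists c; apply: tot_inj; rewrite !totE.
exact: xc.
Qed.

Lemma fcast_linear s t (e : s = t) : linear (@fcast R G B s t e).
Proof. by case: _ / e. Qed.

Lemma lmul_linl t (x : B t) : linear (fun a : A => lmul a x).
Proof. by move=> k a b; rewrite /lmul fmul_linl fcast_linear. Qed.

Lemma ip_linl t (y : B t) : linear (fun x : B t => ip x y).
Proof. by move=> k x x'; rewrite /ip fmul_linr; exact: fcast_linear. Qed.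

Lemma outer_generates t : sc_set (fell_D B t) =
  closed_span [set a : A | exists x y : B t, a = outer x y].
Proof.
rewrite /= DsetE; congr closed_span; apply/seteqP; split=> a.
  by move=> [x [y axy]]; exists x, y; apply: tot_inj; rewrite totE.
by move=> [x [y ->]]; exists x, y; rewrite totE.
Qed.

Lemma ip_generates t : sc_set (fell_D B t^-1) =
  closed_span [set a : A | exists x y : B t, a = ip x y].
Proof.
rewrite outer_generates; congr closed_span; apply/seteqP; split=> a.
  move=> [u [v ->]].
  exists (fcast (invgK t) (fstar v)), (fcast (invgK t) (fstar u)).
  by apply: tot_inj; rewrite !totE tstarK.
move=> [x [y ->]]; exists (fstar y), (fstar x).
by apply: tot_inj; rewrite !totE tstarK.
Qed.

(** [a (x y^* ) = (a x) y^*] and [(x y^* ) a = x (a^* y)^*]. *)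
Lemma fell_D_ideal t (a d : A) : sc_set (fell_D B t) d ->
  sc_set (fell_D B t) (cmul a d) /\ sc_set (fell_D B t) (cmul d a).
Proof.
rewrite outer_generates => Dd; split.
  move: d Dd; apply: closed_span_image => [u v|k v|||_ [x [y ->]]].
  - exact: cmulDr.
  - rewrite cmulZr; apply: linear_subspace_scale.
    exact: closed_span_subspace.
  - exact: cmul0r.
  - apply: (lipschitz_continuous (M := `|a|)) => // u v.
    by rewrite -cmulBr cmul_norm.
  - by apply: closed_span_incl; exists (lmul a x), y; rewrite cmul_outer.
move: d Dd; apply: (closed_span_image (f := fun d : A => cmul d a))
  => [u v|k v|||_ [x [y ->]]].
- exact: cmulDl.
- by rewrite cmulZl; apply: linear_subspace_scale; exact: closed_span_subspace.
- exact: cmul0l.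
- apply: (lipschitz_continuous (M := `|a|)) => // u v.
  by rewrite -cmulBl mulrC cmul_norm.
- by apply: closed_span_incl; exists x, (lmul (cstar a) y); rewrite outer_cmul.
Qed.

End FellOperations.

(** * Representations *)

Section Rep.
Context (R : realType) (A : cstarAlg R).

Section AnyRep.
Variable p : rep A.

Lemma rep_norm_le a x : `|p a x| <= 2 * `|a| * `|x|.
Proof.
rewrite -!hdot_snorm; apply: (action_bound (act := p)).
- by move=> k b c y; exact: (rep_linear p y k b c).
- exact: repM.
- by move=> b y z /=; rewrite -[in RHS](rep_star p) cstarK.
Qed.

Lemma rep_continuous x : continuous (fun a => p a x).
Proof.
apply: (linear_le_continuous (M := 2 * `|x|)).
- exact: rep_linear.
- exact: mulr_ge0.
- by move=> a; rewrite mulrAC; exact: rep_norm_le.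
Qed.

Lemma rep_zero_ind (S : set A) x :
  (forall a, S a -> p a x = 0) -> forall a, closed_span S a -> p a x = 0.
Proof.
move=> Sx a; have c0 : closed [set a | p a x = 0].
  apply: (closed_equalizer (f := fun a => p a x) (g := cst 0)).
    exact: rep_continuous.
  exact: cst_continuous.
rewrite -[p a x = 0]/([set a | p a x = 0] a) ((closure_id _).1 c0).
apply: closureS; apply: linear_span_sub => //; split.
  exact: linear_map0 (rep_linear p x).
by move=> k b c /= bx cx; rewrite [LHS](rep_linear p x) bx cx scaler0 addr0.
Qed.

End AnyRep.

Section Irreducible.
Variable p : irrep A.
Let irr := (irrep_irreducible p).2.

(** For a right ideal [E], the vectors that [E] sends into [M] form a closed
    invariant subspace, since [p c (p a v) = p (c a) v]. *)
Lemma irrep_absorb (E : set A) (M : set (rep_space p)) :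
  (forall a c, E c -> E (cmul c a)) -> linear_subspace M -> closed M ->
  [set v | forall c, E c -> M (p c v)] = [set 0] \/
  [set v | forall c, E c -> M (p c v)] = setT.
Proof.
move=> Ei Ml Mc; apply: irr => [||a v Mv c Ec].
- split=> [c _|k u w /= Mu Mw c Ec].
    by rewrite (linear_map0 (rep_op_linear p c)); exact: Ml.1.
  by rewrite rep_op_linear; apply: Ml.2; [exact: Mu|exact: Mw].
- rewrite (_ : [set v | _] = \bigcap_(c in E) (p c @^-1` M)); last first.
    by apply/seteqP; split.
  apply: closed_bigI => c _; apply: preimage_closed => // v _.
  exact: rep_op_continuous.
- by rewrite -repM; apply: Mv; exact: Ei.
Qed.

Lemma irrep_nondegenerate (J : set A) :
  (forall a d, J d -> J (cmul d a)) ->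
  (exists2 d, J d & exists x, p d x <> 0) ->
  forall v, (forall d, J d -> p d v = 0) -> v = 0.
Proof.
move=> Ji [d Jd [x dx]] v Jv.
have c0 : closed [set (0 : rep_space p)].
  exact/accessible_closed_set1/hausdorff_accessible/norm_hausdorff.
have l0 : linear_subspace [set (0 : rep_space p)].
  by split=> // k _ _ /= -> ->; rewrite scaler0 addr0.
have [M0|MT] := irrep_absorb Ji l0 c0.
  by move/seteqP : M0 => [/(_ v Jv)].
by move/seteqP : MT => [_ /(_ x I d Jd)].
Qed.

Lemma irrep_neq0 v : v <> 0 -> exists a, p a v <> 0.
Proof.
move=> v0; apply: contrapT => /forallNP pv.
apply: v0; apply: (irrep_nondegenerate (J := setT)) => //.
  by have [[a [x ax]] _] := irrep_irreducible p; exists a => //; exists x.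
by move=> d _; apply: contrapT; exact: pv.
Qed.

(** The closed span of [p(A) v] is invariant, and nonzero by
    [irrep_neq0]. *)
Lemma irrep_cyclic v : v <> 0 -> closed_span (range (fun a => p a v)) = setT.
Proof.
move=> v0; pose S := closed_span (range (fun a => p a v)).
have [| | |S0|//] := irr (M := S).
- exact: closed_span_subspace.
- exact: closed_closure.
- rewrite /S => a.
  apply: (closed_span_image (f := p a)) => [x y|k x Sx|||_ [b _ <-]].
  + exact: linear_mapD (rep_op_linear p a) _ _.
  + rewrite (linear_mapZ k x (rep_op_linear p a)).
    exact: linear_subspace_scale (closed_span_subspace _) Sx.
  + exact: linear_map0 (rep_op_linear p a).
  + exact: rep_op_continuous.
  + by apply: closed_span_incl; exists (cmul a b) => //; rewrite repM.
- have [a av] := irrep_neq0 v0; exfalso; apply: av.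
  suff : S (p a v) by rewrite S0.
  by apply: closed_span_incl; exists a.
Qed.

(** Let [M] be nonzero, closed and invariant under the ideal [J].  The vectors
    that [J] sends into [M] contain [M], so they are all vectors; hence the
    vectors that [A] sends into [M] contain the range of [J], and they are
    all vectors as well.  So [M] is invariant under [A]. *)
Lemma irreducible_rep_res (J : subCstar A) :
  (forall a d, sc_set J d -> sc_set J (cmul a d) /\ sc_set J (cmul d a)) ->
  (exists2 d, sc_set J d & exists x, p d x <> 0) -> irreducible (rep_res J p).
Proof.
move=> Ji [d Jd [x dx]]; split; first by exists (exist _ d Jd), x.
move=> M Ml Mc MJ.
have [M0|/existsNP[m /not_implyP[Mm m0]]] := pselect (forall m, M m -> m = 0).
  left; apply/seteqP; split=> [m /M0//|_ ->]; exact: Ml.1.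
right.
have [/seteqP[J0 _]|/seteqP[_ JT]] :=
    irrep_absorb (fun a c Jc => (Ji a c Jc).2) Ml Mc.
  by exfalso; apply/m0/J0 => c Jc; exact: (MJ (exist _ c Jc)).
have [/seteqP[A0 _]|/seteqP[_ AT]] :=
    irrep_absorb (E := setT) (fun _ _ _ => I) Ml Mc.
  exfalso; apply/dx/A0 => c _; rewrite -repM.
  by apply: (JT x I); exact: (Ji c d Jd).1.
have [M0|//] := irr Ml Mc (fun a v _ => AT v I a I).
by case: m0; move: Mm; rewrite M0.
Qed.

End Irreducible.

Lemma unitary_equiv_refl (p : rep A) : unitary_equiv p p.
Proof. by exists id; split=> // y; exists y. Qed.

Lemma spectrum_eq (x y : spectrum A) :
  unitary_equiv (repr x : irrep A) (repr y : irrep A) -> x = y.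
Proof.
by move=> xy; rewrite -[x]reprK -[y]reprK; apply/eqquotP/asboolP.
Qed.

Lemma repr_spectrum (p : irrep A) :
  exists x : spectrum A, unitary_equiv (repr x : irrep A) p.
Proof.
exists (\pi_(spectrum A) p)%qT; apply/asboolP.
have : (\pi_(spectrum A) (repr (\pi_(spectrum A) p)) = \pi_(spectrum A) p)%qT.
  by rewrite reprK.
by move/eqquotP.
Qed.

End Rep.

(** * Induction along a fiber *)

Section TensorMap.
Context (R : realType) (V : normedSpace R[i]).

(** [i x h] stands for [x (x) h] in a completion [K] of the tensor product of
    [V] and [H], for the inner product given by [<L x y h, k>]. *)
Definition tensor_map (H K : hilbertSpace R) (L : V -> V -> H -> H)
    (i : V -> H -> K) : Prop :=
  [/\ (forall h, linear (i^~ h)) /\ (forall x, linear (i x)),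
      forall x y h k, hdot (i x h) (i y k) = hdot (L x y h) k &
      closed_span (range (fun z : V * H => i z.1 z.2)) = setT].

(** The induction between ideals of the unit fiber and the induction from the
    unit fiber to itself are of this form, with different [C] and [D]. *)
Definition induces_via (C D : cstarAlg R) (br : V -> V -> C) (m : D -> V -> V)
    (p : rep C) (q : rep D) : Prop :=
  exists2 i, tensor_map (fun x y => p (br x y)) i &
    forall a x h, q a (i x h) = i (m a x) h.

Lemma dense_image (U W : normedModType R[i]) (f : U -> W) (S : set U)
    (T : set W) : linear f -> continuous f -> (forall w, exists u, f u = w) ->
  closed_span S = setT -> (forall u, S u -> T (f u)) -> closed_span T = setT.
Proof.
move=> fl fc fs ST STf; apply/seteqP; split=> // w _; have [u <-] := fs w.
have [T0 Tl] := closed_span_subspace T.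
apply: (dense_ind (P := f @^-1` closed_span T) ST) => [||x Sx /=].
- split=> [|k x y /= Tx Ty]; first by rewrite /= (linear_map0 fl).
  by rewrite fl; exact: Tl.
- by apply: preimage_closed => [x _|]; [exact: fc|exact: closed_closure].
- by apply: closed_span_incl; exact: STf.
Qed.

Lemma induces_via_equiv (C D : cstarAlg R) (br : V -> V -> C) (m : D -> V -> V)
    (p p' : rep C) (q q' : rep D) :
  unitary_equiv p p' -> unitary_equiv q q' ->
  induces_via br m p q -> induces_via br m p' q'.
Proof.
move=> /unitary_equiv_sym[U [Ul Ud Us Ui]] [W [Wl Wd Ws Wi]].
move=> [i [[il1 il2] ig iT] ia].
exists (fun x h => W (i x (U h))); last by move=> a x h; rewrite -Wi ia.
split.
- split=> [h k x y|x k g h]; first by rewrite il1 Wl.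
  by rewrite Ul il2 Wl.
- by move=> x y h k; rewrite Wd ig -Ui Ud.
- have Wc := isometry_continuous Wl Wd.
  apply: (dense_image Wl Wc Ws iT) => _ [[x h] _ <-] /=.
  by have [h' <-] := Us h; exists (x, h').
Qed.

End TensorMap.

(** Two representations with spanning families that have the same inner products
    and that the algebra moves in the same way. *)
Section DenseIsometry.
Context (R : realType) (A : cstarAlg R) (p q : rep A) (I : Type).
Variables (u : I -> rep_space p) (v : I -> rep_space q).
Hypothesis uT : closed_span (range u) = setT.
Hypothesis uv : forall i j, hdot (v i) (v j) = hdot (u i) (u j).
Hypothesis inter : forall a i, exists j, p a (u i) = u j /\ q a (v i) = v j.

Let dense_intertwiner : exists U : rep_space p -> rep_space q,
  [/\ linear U, forall x y, hdot (U x) (U y) = hdot x y,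
      forall a x, U (p a x) = q a (U x) & forall i, U (u i) = v i].
Proof.
have [U [Ul Ud Uu]] := isometry_extension uv uT; exists U; split=> // a.
have Uc := isometry_continuous Ul Ud.
apply: (dense_eq_linear (f := U \o p a) (g := q a \o U) uT).
- by move=> k x y; rewrite /= rep_op_linear Ul.
- by move=> k x y; rewrite /= Ul rep_op_linear.
- by move=> x; apply: continuous_comp; [exact: rep_op_continuous|exact: Uc].
- by move=> x; apply: continuous_comp; [exact: Uc|exact: rep_op_continuous].
- by move=> _ [i _ <-] /=; rewrite Uu; have [j [-> ->]] := inter a i.
Qed.

Lemma dense_unitary_equiv : closed_span (range v) = setT -> unitary_equiv p q.
Proof.
move=> vT; have [U [Ul Ud Ui Uu]] := dense_intertwiner; exists U; split=> //.
by apply: (isometry_surjective Ul Ud vT) => _ [i _ <-]; exists (u i).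
Qed.

Lemma irreducible_unitary_equiv :
  irreducible q -> (exists x : rep_space p, x <> 0) -> unitary_equiv p q.
Proof.
move=> [_ irr] [x x0]; have [U [Ul Ud Ui Uu]] := dense_intertwiner.
exists U; split=> //.
have [| | |U0|UT] := irr (range U).
- exact: linear_range.
- exact: isometry_range_closed.
- by move=> a _ [y _ <-]; exists (p a y).
- exfalso; apply: x0; apply: hdot_eq0; rewrite -Ud.
  have : range U (U x) by exists x.
  by rewrite U0 => ->; exact: (sdot0l (hdot_semidot _)).
- by move=> y; have : range U y by [rewrite UT]; move=> [z _ <-]; exists z.
Qed.

End DenseIsometry.

Section Induction.
Context (R : realType) (G : groupType) (B : fellBundle R G).
Local Notation A := (unit_fiber B).

Definition induces t (p q : rep A) : Prop :=
  induces_via (@ip R G B t) (@lmul R G B t) p q.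

Definition supports t (p : rep A) : Prop :=
  exists2 d, sc_set (fell_D B t) d & exists x, p d x <> 0.

(** [D_{t^-1}] is an ideal, so no nonzero vector is killed by all of it, and it
    is generated by the elements [y^* x]. *)
Lemma supports_ip t (p : irrep A) v : supports t^-1 p -> v <> 0 ->
  exists x y : B t, p (ip x y) v <> 0.
Proof.
move=> ps v0; apply: contrapT => /forallNP nxy; apply: v0.
apply: (irrep_nondegenerate (J := sc_set (fell_D B t^-1))) => //.
  by move=> a d Dd; exact: (fell_D_ideal a Dd).2.
rewrite ip_generates; apply: rep_zero_ind => _ [x [y ->]].
by apply: contrapT => xy; apply: (nxy x); exists y.
Qed.

Lemma supports_ex t (p : rep A) :
  supports t^-1 p -> exists (x y : B t) v, p (ip x y) v <> 0.
Proof.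
move=> [d Dd [v dv]]; apply: contrapT => nxy; apply: dv.
move: d Dd; rewrite ip_generates; apply: rep_zero_ind => _ [x [y ->]].
by apply: contrapT => xy; apply: nxy; exists x, y, v.
Qed.

Section TensorMapRep.
Variables (t : G) (p : rep A) (K : hilbertSpace R).
Variable i : B t -> rep_space p -> K.
Hypothesis it : tensor_map (fun x y => p (ip x y)) i.
Let il1 := let: And3 (conj l _) _ _ := it in l.
Let il2 := let: And3 (conj _ l) _ _ := it in l.
Let ig := let: And3 _ g _ := it in g.
Let iT := let: And3 _ _ T := it in T.

Lemma tensor_map_bound x : exists2 C, 0 <= C & forall h, `|i x h| <= C * `|h|.
Proof.
pose C := sqrtC (2 * `|ip x x|).
have C0 : 0 <= C by rewrite sqrtC_ge0 mulr_ge0.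
exists C => // h; rewrite -(@ler_pXn2r _ 2)// ?nnegrE ?mulr_ge0//.
rewrite -hdot_norm ig exprMn sqrtCK expr2 mulrA.
rewrite -(ger0_norm (_ : 0 <= hdot (p (ip x x) h) h)); last first.
  by rewrite -ig hdot_norm exprn_ge0.
by rewrite (le_trans (hdot_le _ _))// ler_wpM2r// rep_norm_le.
Qed.

Lemma tensor_map_continuous x : continuous (i x).
Proof.
by have [C C0 iC] := tensor_map_bound x; exact: linear_le_continuous iC.
Qed.

Lemma tensor_map_balanced x a h : i (rmul x a) h = i x (p a h).
Proof.
apply: (hdot_dense_eq iT) => _ [[y k] _ <-] /=.
by rewrite !ig ip_rmulr repM rep_star.
Qed.

End TensorMapRep.

(** The vectors [x (x) h] of the two spaces have the same inner products. *)
Lemma induces_unique t (p q q' : rep A) :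
  induces t p q -> induces t p q' -> unitary_equiv q q'.
Proof.
move=> [i [_ ig iT] ia] [j [_ jg jT] ja].
apply: (dense_unitary_equiv iT (v := fun z => j z.1 z.2)) => //.
  by move=> z z'; rewrite ig jg.
by move=> a [x h]; exists (lmul a x, h); rewrite /= ia ja.
Qed.

(** [x (x) h |-> p x h] is isometric with dense range, as [p] is irreducible. *)
Lemma induces_unit (p : irrep A) (q : rep A) :
  induces 1 p q -> unitary_equiv p q.
Proof.
move=> [i [_ ig iT] ia].
apply: (dense_unitary_equiv (u := fun z : A * rep_space p => p z.1 z.2)
  (v := fun z => i z.1 z.2)) => //.
- have [[a [h ah]] _] := irrep_irreducible p.
  have h0 : h <> 0.
    by move=> h0; apply: ah; rewrite h0 (linear_map0 (rep_op_linear p a)).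
  apply/seteqP; split=> // v _; have : closed_span (range (fun a => p a h)) v.
    by rewrite irrep_cyclic.
  apply: closureS; apply: linear_span_sub; first exact: linear_span_subspace.
  by move=> _ [b _ <-]; apply: linear_span_incl; exists (b, h).
- by move=> [x h] [y k]; rewrite /= ig ip_unit repM rep_star.
- by move=> a [x h]; exists (cmul a x, h); rewrite /= repM ia lmul_unit.
Qed.

(** If [p (y^* x) h] is nonzero and [p (w^* z)] does not kill it, then
    [<z y^* x (x) h, w (x) k> = <p (w^* z) p (y^* x) h, k>] is nonzero for
    some [k], so [q (z y^* )] is nonzero. *)
Lemma induces_supports t (p : irrep A) (q : rep A) :
  supports t^-1 p -> induces t p q -> supports t q.
Proof.
move=> ps [i [_ ig _] ia]; have [x [y [h xyh]]] := supports_ex ps.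
have [z [w zw]] := supports_ip ps xyh.
exists (outer z y).
  by rewrite outer_generates; apply: closed_span_incl; exists z, y.
exists (i x h); rewrite ia => i0; apply: zw; apply: hdot_eq0.
rewrite -repM -ip_rmull -lmul_outer -ig i0; exact: (sdot0l (hdot_semidot _)).
Qed.

End Induction.

(** * Irreducibility and existence of induced representations *)

Section InducedIrreducible.
Context (R : realType) (G : groupType) (B : fellBundle R G) (t : G).
Local Notation A := (unit_fiber B).

(** The adjoint of [i x] exists since [i x] is bounded and since it is known on
    the spanning vectors: [<y (x) k, x (x) h> = <p (x^* y) k, h>]. *)
Lemma tensor_map_adjoint (p : rep A) (K : hilbertSpace R)
    (i : B t -> rep_space p -> K) x :
  tensor_map (fun y z => p (ip y z)) i ->
  exists adj : K -> rep_space p, [/\ linear adj, continuous adj,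
    forall w h, hdot (adj w) h = hdot w (i x h) &
    forall y k, adj (i y k) = p (ip y x) k].
Proof.
move=> it; have [[il1 il2] ig iT] := it.
have [C C0 iC] := tensor_map_bound it x.
pose S := range (fun z : B t * rep_space p => (i z.1 z.2, p (ip z.1 x) z.2)
  : K * rep_space p).
have Sl := linear_span_subspace S.
have adj g : linear_span S g -> forall h, hdot g.2 h = hdot g.1 (i x h).
  move=> Sg h; move: g Sg; apply: linear_span_sub => [|_ [[y k] _ <-] /=].
    split=> [|k g g' /= gh gh'].
      by rewrite [LHS](sdot0l (hdot_semidot _)) [RHS](sdot0l (hdot_semidot _)).
    by rewrite [LHS](hdot_linear h) [RHS](hdot_linear (i x h)) gh gh'.
  by rewrite ig.
have [||T [Tl TC TS]] := bounded_extension Sl C0.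
- move=> g Sg; have [->|g0] := eqVneq g.2 0; first by rewrite normr0 mulr_ge0.
  rewrite -(@ler_pM2r _ `|g.2|) ?normr_gt0// -expr2 -hdot_norm adj//.
  rewrite -(ger0_norm (_ : 0 <= hdot g.1 (i x g.2))); last first.
    by rewrite -adj// hdot_norm exprn_ge0.
  rewrite (le_trans (hdot_le _ _))// [C * _]mulrC -mulrA ler_wpM2l//.
- apply/seteqP; split=> // w _.
  have : closed_span (range (fun z : B t * rep_space p => i z.1 z.2)) w.
    by rewrite iT.
  apply: closureS; apply: linear_span_sub.
    split; first by exists 0 => //; exact: Sl.1.
    move=> k _ _ [g Gg <-] [g' Gg' <-]; exists (k *: g + g') => //.
    exact: Sl.2.
  move=> _ [z _ <-]; exists (i z.1 z.2, p (ip z.1 x) z.2) => //.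
  by apply: linear_span_incl; exists z.
have Ti y k : T (i y k) = p (ip y x) k.
  by apply: (TS (i y k, p (ip y x) k)); apply: linear_span_incl; exists (y, k).
have Tc := linear_le_continuous Tl C0 TC.
exists T; split=> // w h.
apply: (@dense_eq_linear _ K (R[i]^o) _
  (fun w => hdot (T w) h) (fun w => hdot w (i x h)) iT) => [k u v|k u v|||].
- by rewrite Tl; exact: (hdot_linear h).
- exact: (hdot_linear (i x h)).
- move=> v; apply: (@continuous_comp _ _ (R[i]^o) T (fun z => hdot z h)).
    exact: Tc.
  exact: hdot_continuous.
- exact: hdot_continuous.
- by move=> _ [[y k] _ <-] /=; rewrite Ti ig.
Qed.

(** If [M] is closed and invariant, so is the set [N] of the [h] with
    [i x h] in [M] for all [x].  If [N] is everything, then so is [M].  The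
    operator of [z x^*] is the composite of [i z] with the adjoint of [i x], so
    this adjoint maps [M] into [N]; hence if [N] is zero, then [M] is orthogonal
    to every [i x h], so it is zero. *)
Lemma induces_irreducible (p : irrep A) (q : rep A) :
  supports t^-1 p -> induces t p q -> irreducible q.
Proof.
move=> ps pq; have [d _ [v dv]] := induces_supports ps pq.
split; first by exists d, v.
move=> M Ml Mc Minv; have [i it ia] := pq; have [[il1 il2] ig iT] := it.
have [M0|/existsNP[m /not_implyP[Mm m0]]] := pselect (forall m, M m -> m = 0).
  left; apply/seteqP; split=> [m /M0//|_ ->]; exact: Ml.1.
right; pose N := [set h | forall x, M (i x h)].
have [| | |N0|NT] := (irrep_irreducible p).2 N.
- split=> [x|k h h' Nh Nh' x].
    by rewrite (linear_map0 (il2 x)); exact: Ml.1.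
  by rewrite il2; exact: Ml.2.
- rewrite (_ : N = \bigcap_(x in setT) (i x @^-1` M)); last first.
    by apply/seteqP; split=> [h Nh x _|h Nh x]; [exact: Nh|exact: Nh].
  apply: closed_bigI => x _; apply: preimage_closed => // h _.
  exact: tensor_map_continuous.
- by move=> a h Nh x; rewrite -(tensor_map_balanced it).
- exfalso; apply: m0; apply: (hdot_dense_eq iT) => _ [[x h] _ <-] /=.
  rewrite [RHS](sdot0r (hdot_semidot _)).
  have [adj [adjl adjc adjd adji]] := tensor_map_adjoint x it.
  have iadj z w : i z (adj w) = q (outer z x) w.
    apply: (dense_eq_linear (f := i z \o adj) (g := q (outer z x)) iT).
    + by move=> k u u'; rewrite /= adjl il2.
    + exact: rep_op_linear.
    + move=> u; apply: continuous_comp; first exact: adjc.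
      exact: tensor_map_continuous.
    + exact: rep_op_continuous.
    + move=> _ [[y k] _ <-] /=; rewrite adji ia lmul_outer.
      by rewrite (tensor_map_balanced it).
  have : N (adj m) by move=> z; rewrite iadj; exact: Minv.
  rewrite N0 /= => am; rewrite hdot_conj -adjd am.
  by rewrite [hdot _ _](sdot0l (hdot_semidot _)) rmorph0.
- apply/seteqP; split=> // w _; apply: (dense_ind iT Ml Mc) => _ [[x h] _ <-].
  by have : N h by [rewrite NT]; exact.
Qed.

End InducedIrreducible.

(** The completion of [B t] for the semi-inner product [<p(y^* x) h0, h0>]
    carries the induced representation: since [h0] is cyclic, the vectors
    [x (x) h0] are already dense in the tensor product. *)
Section InducedSpace.
Context (R : realType) (G : groupType) (B : fellBundle R G) (t : G).
Local Notation A := (unit_fiber B).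
Variables (p : irrep A) (h0 : rep_space p).
Hypothesis h0_neq0 : h0 <> 0.

Let s0 (x y : B t) : R[i] := hdot (p (ip x y) h0) h0.

Let s0_linear y : scalar (s0^~ y).
Proof.
move=> k x x'; rewrite /s0 ip_linl [p _ _](rep_linear p h0).
exact: (hdot_linear h0).
Qed.

Let s0_conj x y : s0 x y = (s0 y x)^*.
Proof. by rewrite /s0 -[RHS]hdot_conj -(rep_star p) cstar_ip. Qed.

Let s0_ge0 x : 0 <= s0 x x.
Proof.
have [c xc] := ip_pos x; rewrite /s0 xc repM (rep_star p) hdot_norm.
exact: exprn_ge0.
Qed.

Definition ind_dot : semidot (B t) := Semidot s0_linear s0_conj s0_ge0.
Local Notation s := ind_dot.
Local Notation K := (completion s).
Local Notation ev f := (sval (f : completion_car s)).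

Lemma ind_dot_bound a (x : B t) : snorm s (lmul a x) <= 2 * `|a| * snorm s x.
Proof.
apply: (action_bound (act := fun a (x : B t) => lmul a x)).
- by move=> k b c y; exact: (lmul_linl y k b c).
- exact: lmulM.
- by move=> b y z; rewrite /= /s0 ip_lmul.
Qed.

(** The elements of the completion are limits of the functions [s x -], so they
    are semilinear as well. *)
Lemma ev_semilinear (f : K) (k : R[i]) x y :
  ev f (k *: x + y) = k^* * ev f x + ev f y.
Proof.
have el : embed s (k *: x + y) = k *: embed s x + embed s y.
  by apply: completion_ext => z; rewrite completion_linE; exact: s0_linear.
have rep z : ev f z = completion_dot s f (embed s z).
  by rewrite [RHS]reproducing.
by rewrite !rep el sdotDr sdotZr.
Qed.

Lemma ind_op_approximable a (f : K) :
  approximable s (fun y => ev f (lmul (cstar a) y)).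
Proof.
move=> e e0; have a1 : 0 < 2 * `|cstar a| + 1 by rewrite ltr_wpDl// mulr_ge0.
have [x fx] := svalP (f : completion_car s) _ (divr_gt0 e0 a1).
exists (lmul a x) => y; rewrite [s _ _]/(s0 _ _) /s0 ip_lmul.
rewrite (le_trans (fx _))//.
apply: (le_trans (ler_wpM2l _ (ind_dot_bound _ _))).
  by rewrite divr_ge0// ltW.
rewrite mulrA ler_wpM2r ?snorm_ge0// mulrAC ler_pdivrMr// ler_wpM2l ?(ltW e0)//.
by rewrite lerDl.
Qed.

(** [(a f)(y) = f(a^* y)] is forced by the reproducing property:
    [<a f, y> = <f, a^* y>]. *)
Definition ind_op a (f : K) : K := exist _ _ (ind_op_approximable a f).

Lemma ind_op_embed a x : ind_op a (embed s x : K) = embed s (lmul a x).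
Proof. by apply: completion_ext => y; rewrite /= /s0 ip_lmul. Qed.

Lemma ind_op_linear a : linear (ind_op a).
Proof.
move=> k f g; apply: completion_ext => y.
by rewrite completion_linE /= -completion_linE.
Qed.

Lemma ind_op_continuous a : continuous (ind_op a).
Proof.
apply: (linear_le_continuous (M := 2 * `|cstar a|) (ind_op_linear a)).
  exact: mulr_ge0.
move=> f; apply: completion_norm_le; first by rewrite !mulr_ge0.
move=> y; apply: (le_trans (ev_le f (lmul (cstar a) y))).
apply: (le_trans (ler_wpM2l (snorm_ge0 _ _) (ind_dot_bound _ _))).
by rewrite mulrA [X in X * _]mulrC.
Qed.

Lemma ind_op_linear_l f : linear (fun a => ind_op a f).
Proof.
move=> k a b; apply: completion_ext => y; rewrite completion_linE.
rewrite -[LHS]/(ev f (lmul (cstar (k *: a + b)) y)).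
by rewrite cstar_semilin lmul_linl ev_semilinear conjCK.
Qed.

Lemma ind_opM a b f : ind_op (cmul a b) f = ind_op a (ind_op b f).
Proof.
apply: completion_ext => y; rewrite -[LHS]/(ev f (lmul (cstar (cmul a b)) y)).
by rewrite cstarM lmulM.
Qed.

Lemma ind_op_star a f g : hdot (ind_op (cstar a) f) g = hdot f (ind_op a g).
Proof.
rewrite hdot_conj [RHS]hdot_conj; congr (_^*).
apply: (@dense_eq_linear _ K (R[i]^o) _ (fun g => hdot g (ind_op (cstar a) f))
  (fun g => hdot (ind_op a g) f) (completion_dense s)).
- by move=> k u v; exact: (hdot_linear (ind_op (cstar a) f)).
- by move=> k u v; rewrite ind_op_linear; exact: (hdot_linear f).
- exact: hdot_continuous.
- move=> u.
  apply: (@continuous_comp _ _ (R[i]^o) (ind_op a) (fun g => hdot g f)).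
    exact: ind_op_continuous.
  exact: hdot_continuous.
- move=> _ [x _ <-]; rewrite ind_op_embed hdot_conj [RHS]hdot_conj; congr (_^*).
  rewrite [LHS]reproducing [RHS]reproducing.
  by rewrite -[LHS]/(ev f (lmul (cstar (cstar a)) x)) cstarK.
Qed.

Definition ind_rep : rep A :=
  Rep ind_op_linear ind_op_continuous ind_op_linear_l ind_opM ind_op_star.

(** The vector [p(x^* y) h0] is the value at [y] of the adjoint of
    [h |-> x (x) h], which is to be bounded; the square of its norm is
    [<p(y^* x x^* y) h0, h0>], and [x x^*] acts boundedly on [B_t]. *)
Lemma ind_adjoint_bound (x : B t) : exists2 C, 0 <= C &
  forall y, `|p (ip y x) h0| <= C * snorm s y.
Proof.
pose C := sqrtC (2 * `|outer x x|).
have C0 : 0 <= C by rewrite sqrtC_ge0 mulr_ge0.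
exists C => // y; rewrite -(@ler_pXn2r _ 2)// ?nnegrE ?mulr_ge0 ?snorm_ge0//.
rewrite -hdot_norm -[hdot _ _]ger0_norm ?hdot_ge0// exprMn sqrtCK.
have -> : hdot (p (ip y x) h0) (p (ip y x) h0) = s (lmul (outer x x) y) y.
  by rewrite /= /s0 lmul_outer ip_rmull repM -(cstar_ip y x) (rep_star p).
rewrite (le_trans (cauchy_schwarz _ _ _))// expr2 mulrA ler_wpM2r ?snorm_ge0//.
exact: ind_dot_bound.
Qed.

(** The value at [y] of the vector [x (x) h], which is its inner product with
    [y (x) h0]. *)
Let phi (x : B t) (h : rep_space p) (y : B t) : R[i] := hdot (p (ip x y) h) h0.

Let phiE x h y : phi x h y = hdot h (p (ip y x) h0).
Proof. by rewrite /phi -(cstar_ip y x) (rep_star p). Qed.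

Let phi_approx x (C : R[i]) : (forall y, `|p (ip y x) h0| <= C * snorm s y) ->
  forall a h, approximates s (phi x h) (rmul x a) (C * `|h - p a h0|).
Proof.
move=> xC a h y; have -> : s (rmul x a) y = phi x (p a h0) y.
  by rewrite /= /s0 ip_rmull repM.
rewrite !phiE -hdotBl (le_trans (hdot_le _ _))//.
by rewrite [leRHS]mulrAC mulrC ler_wpM2r.
Qed.

Let phi_approximable x h : approximable s (phi x h).
Proof.
move=> e e0; have [C C0 xC] := ind_adjoint_bound x.
have C1 : 0 < C + 1 by rewrite ltr_wpDl.
have : closed_span (range (fun a => p a h0)) h by rewrite irrep_cyclic.
move=> /(_ (ball h (e / (C + 1)))) [].
  by apply: nbhsx_ballx; rewrite divr_gt0.
move=> v [pv]; rewrite -ball_normE /= => hv.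
have [a av] : exists a, p a h0 = v.
  have : range (fun a => p a h0) v.
    move: v pv {hv}; apply: linear_span_sub => //.
    exact: linear_range (rep_linear p h0).
  by move=> [a _ <-]; exists a.
exists (rmul x a) => y; rewrite (le_trans (phi_approx xC a h y))//.
rewrite ler_wpM2r ?snorm_ge0// av.
apply: (le_trans (ler_wpM2l C0 (ltW hv))); rewrite mulrCA ler_piMr ?(ltW e0)//.
by rewrite ler_pdivrMr// mul1r lerDl.
Qed.

Definition ind_map (x : B t) (h : rep_space p) : K :=
  exist _ _ (phi_approximable x h).

Lemma ind_map_linear_l h : linear (fun x => ind_map x h).
Proof.
move=> k x x'; apply: completion_ext => y; rewrite completion_linE /= /phi.
by rewrite ip_linl [p _ _](rep_linear p h); exact: (hdot_linear h0).
Qed.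

Lemma ind_map_linear_r x : linear (ind_map x).
Proof.
move=> k h h'; apply: completion_ext => y; rewrite completion_linE /= /phi.
by rewrite rep_op_linear; exact: (hdot_linear h0).
Qed.

Lemma ind_map_continuous x : continuous (ind_map x).
Proof.
have [C C0 xC] := ind_adjoint_bound x.
apply: (linear_le_continuous (ind_map_linear_r x) C0) => h.
apply: completion_norm_le; first exact: mulr_ge0.
move=> y; rewrite [ev _ _]phiE (le_trans (hdot_le _ _))//.
by rewrite [leRHS]mulrAC mulrC ler_wpM2r.
Qed.

Lemma ind_map_embed x a : ind_map x (p a h0) = embed s (rmul x a).
Proof. by apply: completion_ext => y; rewrite /= /phi /s0 ip_rmull repM. Qed.

Lemma ind_tensor_map : tensor_map (fun x y => p (ip x y)) ind_map.
Proof.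
split.
- by split; [exact: ind_map_linear_l|exact: ind_map_linear_r].
- move=> x y h k; rewrite hdot_conj [RHS]hdot_conj; congr (_^*).
  apply: (@dense_eq_linear _ (rep_space p) (R[i]^o) _
    (fun k => hdot (ind_map y k) (ind_map x h)) (fun k => hdot k (p (ip x y) h))
    (irrep_cyclic h0_neq0)).
  + move=> c u v; rewrite ind_map_linear_r.
    exact: (hdot_linear (ind_map x h)).
  + by move=> c u v; exact: (hdot_linear (p (ip x y) h)).
  + move=> u; apply: (@continuous_comp _ _ (R[i]^o) (ind_map y)
      (fun g => hdot g (ind_map x h))); first exact: ind_map_continuous.
    exact: hdot_continuous.
  + exact: hdot_continuous.
  + move=> _ [a _ <-]; rewrite ind_map_embed hdot_conj [RHS]hdot_conj.
    congr (_^*).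
    rewrite [LHS]reproducing -[LHS]/(hdot (p (ip x (rmul y a)) h) h0).
    by rewrite ip_rmulr repM (rep_star p).
- apply/seteqP; split=> // f _.
  have : closed_span (range (embed s : B t -> K)) f by rewrite completion_dense.
  apply: closureS; apply: linear_span_sub; first exact: linear_span_subspace.
  move=> _ [x _ <-]; apply: linear_span_incl; exists (x, h0) => //=.
  exact: completion_ext.
Qed.

Lemma induces_ind_rep : induces t p ind_rep.
Proof.
exists ind_map; first exact: ind_tensor_map.
by move=> a x h; apply: completion_ext => y; rewrite /= /phi ip_lmul.
Qed.

End InducedSpace.

Section InducedExists.
Context (R : realType) (G : groupType) (B : fellBundle R G).
Local Notation A := (unit_fiber B).

Lemma induces_exists t (p : irrep A) : supports t^-1 p ->
  exists q : irrep A, induces t p q.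
Proof.
move=> ps; have [d _ [v dv]] := ps.
have v0 : v <> 0.
  by move=> v0; apply: dv; rewrite v0 (linear_map0 (rep_op_linear p d)).
have pq := @induces_ind_rep _ _ _ t p v v0.
by exists (Irrep (induces_irreducible ps pq)).
Qed.

(** The representation [r] acts on the span of the vectors [x (x) (y (x) h)],
    which have the inner products of the vectors [xy (x) h] of the
    representation [r'] induced along [s t].  So [r] embeds in [r'], which is
    irreducible.  These inner products also show that [p] does not vanish on
    [D_{(s t)^-1}], as required for the existence of [r']. *)
Lemma induces_comp s t (p q r : irrep A) :
  supports t^-1 p -> supports s^-1 q -> induces t p q -> induces s q r ->
  supports (s * t)^-1 p /\ induces (s * t) p r.
Proof.
move=> ps qs pq qr.
have [i it ia] := pq; have [[il1 il2] ig iT] := it.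
have [j jt ja] := qr; have [[jl1 jl2] jg jT] := jt.
pose u (z : B s * (B t * rep_space p)) := j z.1 (i z.2.1 z.2.2).
have ug z z' : hdot (u z) (u z') =
    hdot (p (ip (fmul z.1 z.2.1) (fmul z'.1 z'.2.1)) z.2.2) z'.2.2.
  by rewrite jg ia ig ip_fmul.
have uT : closed_span (range u) = setT.
  have [S0 Sl] := closed_span_subspace (range u).
  apply/seteqP; split=> // w _; apply: (dense_ind jT) => [||_ [[x w'] _ <-] /=].
  - exact: closed_span_subspace.
  - exact: closed_closure.
  apply: (dense_ind (P := j x @^-1` closed_span (range u)) iT)
    => [||_ [[y h] _ <-]].
  - split=> [|k h h' /= Sh Sh']; first by rewrite /= (linear_map0 (jl2 x)).
    by rewrite jl2; exact: Sl.
  - apply: preimage_closed => [h _|]; last exact: closed_closure.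
    exact: tensor_map_continuous.
  - by apply: closed_span_incl; exists (x, (y, h)).
have [z uz] : exists z, u z <> 0.
  apply: contrapT => /forallNP u0.
  have [[a [w aw]] _] := irrep_irreducible r.
  have w0 : w <> 0.
    by move=> w0; apply: aw; rewrite w0 (linear_map0 (rep_op_linear r a)).
  apply: w0; apply: (hdot_dense_eq uT) => _ [z _ <-].
  have -> : u z = 0 by apply: contrapT; exact: u0.
  by rewrite ![hdot 0 _](sdot0l (hdot_semidot _)).
have sp : supports (s * t)^-1 p.
  exists (ip (fmul z.1 z.2.1) (fmul z.1 z.2.1)).
    by rewrite ip_generates; apply: closed_span_incl; eexists; eexists.
  exists z.2.2 => pz; apply: uz; apply: hdot_eq0; rewrite ug pz.
  exact: (sdot0l (hdot_semidot _)).
split=> //; have [r' pr'] := induces_exists sp.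
have [k [_ kg _] ka] := pr'.
suff /unitary_equiv_sym rr : unitary_equiv r r'.
  exact: induces_via_equiv (unitary_equiv_refl _) rr pr'.
apply: (irreducible_unitary_equiv uT (v := fun z => k (fmul z.1 z.2.1) z.2.2)).
- by move=> z1 z2; rewrite kg ug.
- move=> a [x [y h]]; exists (lmul a x, (y, h)); rewrite /u /= ja ka.
  by rewrite lmul_fmul.
- exact: irrep_irreducible.
- by exists (u z).
Qed.

End InducedExists.

(** * The partial action on the spectrum *)

Section SpectrumTopology.
Context (R : realType) (A : cstarAlg R).

Lemma open_not_sub_ker (E : set A) :
  open [set x : spectrum A | ~ (E `<=` rep_ker (repr x : irrep A))].
Proof.
exists [set P : prim A | ~ (E `<=` sval P)] => //.
rewrite /open /= /prim_open /= => P EP /=; apply => a Ea.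
by apply: EP => Q /= /contrapT; apply.
Qed.

(** A closed set of primitive ideals is the set of those that contain the
    intersection of its members. *)
Lemma open_spectrum_ker (V : set (spectrum A)) : open V ->
  exists E : set A, V = [set x | ~ (E `<=` rep_ker (repr x : irrep A))].
Proof.
move=> [W oW <-]; exists (\bigcap_(Q in ~` W) sval Q).
apply/seteqP; split=> x /= Wx.
  by move=> sub; exact: (oW (spectrum_ker x) sub).
by apply: contrapT => nW; apply: Wx => a Ea; exact: (Ea (spectrum_ker x) nW).
Qed.

End SpectrumTopology.

Section PartialAction.
Context (R : realType) (G : groupType) (B : fellBundle R G).
Local Notation A := (unit_fiber B).
Implicit Types x y z : spectrum A.

Lemma is_Ind_via t (p : rep (fell_D B t^-1)) (q : rep (fell_D B t)) :
  is_Ind p q <-> induces_via (@dip R G B t) (@lact R G B t) p q.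
Proof.
have imE (i : B t -> rep_space p -> rep_space q) :
    [set i x h | x in setT & h in setT] =
    range (fun u : B t * rep_space p => i u.1 u.2).
  apply/seteqP; split=> w; first by move=> [x _ [h _ <-]]; exists (x, h).
  by move=> [[x h] _ <-]; exists x => //; exists h.
split=> [[i [il ig iT ia]]|[i [il ig iT] ia]]; exists i => //.
  by split=> //; rewrite -imE.
by split=> //; rewrite imE.
Qed.

(** From the left to the right, the map [i] for the restrictions to [D_{t^-1}]
    and [D_t] also intertwines the actions of [a] in [A]: for [c] in [D_t] both
    sides of [q a (i z h) = i (a z) h] have the image [i (c a z) h] under [q c],
    and no nonzero vector is killed by [q c] for all [c] in [D_t]. *)
Lemma alpha_hatP t x y : alpha_hat t x y <->
  fell_X t^-1 x /\ induces t (repr x : irrep A) (repr y : irrep A).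
Proof.
split.
  move=> [x' [y' [[Xx xx'] /is_Ind_via xy' [[d Dd Xy] yy']]]]; split=> //.
  have [i it ia] := induces_via_equiv xx' yy' xy'.
  exists i => // a z h; apply/subr0_eq.
  apply: (irrep_nondegenerate (p := repr y : irrep A)
    (J := sc_set (fell_D B t))).
  - by move=> b c Dc; exact: (fell_D_ideal b Dc).2.
  - by exists d.
  move=> c Dc; have Dca := (fell_D_ideal a Dc).2.
  rewrite (linear_mapB (rep_op_linear _ _)) -repM.
  have := ia (exist _ c Dc) (lmul a z) h; rewrite /= => ->.
  have := ia (exist _ _ Dca) z h; rewrite /= => ->.
  by rewrite -[lact _ z]/(lmul (cmul c a) z) lmulM subrr.
move=> [Xx xy].
have Xy : supports t (repr y : irrep A) := induces_supports Xx xy.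
have [x' xx'] :=
  repr_spectrum (Irrep (irreducible_rep_res (@fell_D_ideal _ _ B t^-1) Xx)).
have [y' yy'] :=
  repr_spectrum (Irrep (irreducible_rep_res (@fell_D_ideal _ _ B t) Xy)).
exists x', y'; split; [by split| |by split].
apply/is_Ind_via.
apply: (induces_via_equiv (unitary_equiv_sym xx') (unitary_equiv_sym yy')).
have [i it ia] := xy; exists i => // a z h; exact: ia.
Qed.

(** [<q a (x (x) h), y (x) k> = <p (y^* a x) h, k>]. *)
Lemma induces_ker t (p q : rep A) (E : set A) : induces t p q ->
  (E `<=` rep_ker q <->
   [set b | exists a (x y : B t), E a /\ b = ip (lmul a x) y] `<=` rep_ker p).
Proof.
move=> [i [_ ig iT] ia]; split=> [Eq _ [a [x [y [Ea ->]]]] h|Ep a Ea].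
  apply: hdot_eq0; rewrite -ig -ia Eq//; exact: (sdot0l (hdot_semidot _)).
apply: (dense_eq_linear (f := q a) (g := fun=> 0) iT).
- exact: rep_op_linear.
- by move=> k u v; rewrite scaler0 addr0.
- exact: rep_op_continuous.
- exact: cst_continuous.
- move=> _ [[x h] _ <-] /=; rewrite ia.
  apply: (hdot_dense_eq iT) => _ [[y k] _ <-] /=.
  rewrite [RHS](sdot0r (hdot_semidot _)) hdot_conj ig Ep.
    by rewrite [hdot 0 _](sdot0l (hdot_semidot _)) rmorph0.
  by exists a, x, y.
Qed.

Lemma induces_continuous t (f : spectrum A -> spectrum A) :
  (forall x, fell_X t^-1 x ->
     induces t (repr x : irrep A) (repr (f x) : irrep A)) ->
  {within @fell_X R G B t^-1, continuous f}.
Proof.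
move=> fi; apply/continuousP => V /open_spectrum_ker[E ->].
pose E' := [set b : A | exists a (x y : B t), E a /\ b = ip (lmul a x) y].
apply/open_subspaceP.
exists [set x : spectrum A | ~ (E' `<=` rep_ker (repr x : irrep A))].
  exact: open_not_sub_ker.
apply/seteqP; split=> x [Ex Xx]; split=> // fx; apply: Ex;
  exact/(induces_ker E (fi _ Xx)).
Qed.

Lemma fell_X_open t : open (@fell_X R G B t).
Proof.
rewrite (_ : fell_X t =
    [set x | ~ (sc_set (fell_D B t) `<=` rep_ker (repr x : irrep A))]).
  exact: open_not_sub_ker.
apply/seteqP; split=> [x [d Dd [v dv]] sub|x /existsNP[d]].
  by apply: dv; exact: sub.
move=> /not_implyP[Dd /existsNP[v dv]].
by exists d => //; exists v.
Qed.

(** If [p a v] is nonzero, then so is some [p (b a) v], and [b a = (b^* )^* a]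
    is one of the inner products that generate [D_e]. *)
Lemma fell_X_unit : @fell_X R G B 1 = setT.
Proof.
apply/seteqP; split=> // x _.
have [[a [v av]] _] := irrep_irreducible (repr x : irrep A).
have : fell_X 1^-1 x.
  have [b bav] := irrep_neq0 av; exists (ip (a : B 1%g) (cstar b)).
    by rewrite ip_generates; apply: closed_span_incl; exists a, (cstar b).
  by exists v; rewrite ip_unit cstarK repM.
by rewrite invg1.
Qed.

Lemma induces_spectrum_exists t x : fell_X t^-1 x ->
  exists y, induces t (repr x : irrep A) (repr y : irrep A).
Proof.
move=> Xx; have [q xq] := induces_exists Xx.
have [y /unitary_equiv_sym yq] := repr_spectrum q.
by exists y; exact: induces_via_equiv (unitary_equiv_refl _) yq xq.
Qed.

Lemma induces_spectrum_unique t x y z :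
  induces t (repr x : irrep A) (repr y : irrep A) ->
  induces t (repr x : irrep A) (repr z : irrep A) -> y = z.
Proof. by move=> xy xz; apply/spectrum_eq/(induces_unique xy xz). Qed.

(** Inducing [y] along [t^-1] gives a class which is induced from [x] along the
    unit. *)
Lemma induces_inv t x y : fell_X t^-1 x ->
  induces t (repr x : irrep A) (repr y : irrep A) ->
  induces t^-1 (repr y : irrep A) (repr x : irrep A).
Proof.
move=> Xx xy; have Xy : fell_X (t^-1)^-1 y.
  by rewrite invgK; exact: induces_supports Xx xy.
have [z yz] := induces_spectrum_exists Xy.
have [_] := induces_comp Xx Xy xy yz; rewrite mulVg => xz.
by rewrite (spectrum_eq (induces_unit xz)).
Qed.

Lemma alpha_hat_homeomorphism t :
  homeomorphism_graph (@fell_X R G B t^-1) (fell_X t) (@alpha_hat R G B t).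
Proof.
have choose s : exists f : spectrum A -> spectrum A, forall x, fell_X s^-1 x ->
    induces s (repr x : irrep A) (repr (f x) : irrep A).
  suff /choice[f fP] : forall x, exists y, fell_X s^-1 x ->
      induces s (repr x : irrep A) (repr y : irrep A) by exists f.
  move=> x; have [/induces_spectrum_exists[y xy]|nX] := pselect (fell_X s^-1 x).
    by exists y.
  by exists x.
have [f fP] := choose t; have [g gP] := choose t^-1%g.
have fgK s f1 g1 : (forall x, fell_X s^-1 x ->
      induces s (repr x : irrep A) (repr (f1 x) : irrep A)) ->
    (forall x, fell_X (s^-1)^-1 x ->
      induces s^-1 (repr x : irrep A) (repr (g1 x) : irrep A)) ->
    forall x, fell_X s^-1 x -> fell_X s (f1 x) /\ g1 (f1 x) = x.
  move=> f1P g1P x Xx.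
  have Xf : fell_X s (f1 x) := induces_supports Xx (f1P _ Xx); split=> //.
  apply: (induces_spectrum_unique (g1P _ _) (induces_inv Xx (f1P _ Xx))).
  by rewrite invgK.
exists f, g; split.
- move=> x y; split=> [/alpha_hatP[Xx xy]|[Xx ->]]; last first.
    by apply/alpha_hatP; split; [|exact: fP].
  by split=> //; exact: induces_spectrum_unique xy (fP _ Xx).
- exact: fgK.
- by have := fgK t^-1%g g f gP; rewrite !invgK; apply.
- exact: induces_continuous.
- by rewrite -(invgK t); apply: induces_continuous => x; exact: gP.
Qed.

End PartialAction.

Theorem proposition2p2 (R : realType) (G : groupType) (B : fellBundle R G) :
  partial_action (@fell_X R G B) (@alpha_hat R G B).
Proof.
split.
- exact: fell_X_open.
- exact: alpha_hat_homeomorphism.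
- exact: fell_X_unit.
- have XT x : @fell_X R G B 1^-1 x by rewrite invg1 fell_X_unit.
  move=> x y; split=> [/alpha_hatP[_ /induces_unit/spectrum_eq //]|->].
  have [z xz] := induces_spectrum_exists (XT x).
  by apply/alpha_hatP; split=> //; rewrite {2}(spectrum_eq (induces_unit xz)).
- move=> s t x y z /alpha_hatP[Xx xy] /alpha_hatP[Xy yz]; apply/alpha_hatP.
  exact: induces_comp Xx Xy xy yz.
Qed.
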